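(* Let $X$ be a connected complex analytic manifold, let $q : Y \to X$ be a Galois cover with automorphism group $\pi := \mathrm{Aut}_X(Y)$, and let $G$ be a complex Lie group. (1) If $p : \mathcal{G} \to X$ is a $(\pi, G)$-group bundle, then there exist a crossed morphism $\varphi : \pi \to \mathrm{Maps}(Y, \mathrm{Aut}(G))$ and an isomorphism of group bundles $\mathcal{G} \simeq \pi \backslash (Y \times G)$ over $X \simeq \pi\backslash Y$, where $f \in \pi$ acts to the left on $(y,g) \in Y \times G$ via $\tau_f(y,g) := (f(y), \varphi_f(y)(g))$. (2) Moreover, if $\varphi$ and $\varphi'$ are crossed morphisms from $\pi$ to $\mathrm{Maps}(Y, \mathrm{Aut}(G))$, then the associated group bundles $\mathcal{G}$ and $\mathcal{G}'$ (the quotients of $Y \times G$ by the actions of $\pi$ defined as in (1) by $\varphi$ and $\varphi'$ respectively) are isomorphic over $X$ if and only if $\varphi$ and $\varphi'$ are conjugate under the left action $\bullet$ of $\mathrm{Maps}(Y,\mathrm{Aut}(G))$ on crossed morphisms. So the set of isomorphism classes of $(\pi,G)$-group bundles is in bijection with the group cohomology set $$H^1\big(\pi, \mathrm{Maps}(Y, \mathrm{Aut}(G))\big) := \mathrm{Maps}(Y, \mathrm{Aut}(G)) \,\backslash\, Z^1\big(\pi, \mathrm{Maps}(Y, \mathrm{Aut}(G))\big).$$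
   Context: A group bundle on a complex analytic manifold $X$ is a complex analytic manifold $\mathcal{G}$ with a holomorphic map $p : \mathcal{G} \to X$ such that (i) every fibre $\mathcal{G}_x := p^{-1}(x)$ is a complex Lie group; (ii) every $x \in X$ has an open neighbourhood $U$ and an isomorphism of complex analytic manifolds $\Phi_U : p^{-1}(U) \to U \times p^{-1}(x)$, compatible with the projections to $U$, whose restriction $p^{-1}(y) \to p^{-1}(x)$ is an isomorphism of complex Lie groups for all $y \in U$. A morphism of group bundles over $X$ is a holomorphic map over $X$ which restricts to a homomorphism of complex Lie groups on each fibre. A Galois cover $q : Y \to X$ is a covering with $Y$ connected such that, with $\pi := \mathrm{Aut}_X(Y)$ the group of automorphisms of the covering, the induced map $\pi \backslash Y \to X$ is an isomorphism (equivalently, $\pi$ acts transitively on the fibres of $q$). A $(\pi,G)$-group bundle is a group bundle $\mathcal{G} \to X$ such that the pullback $q^*\mathcal{G} := Y \times_X \mathcal{G}$ is isomorphic to $Y \times G$ as a group bundle on $Y$. $\mathrm{Aut}(G)$ is the group of complex analytic group automorphisms of $G$. $\mathrm{Maps}(Y, \mathrm{Aut}(G))$ is the set of holomorphic maps $\lambda : Y \to \mathrm{Aut}(G)$ (holomorphy meaning that $(y,g) \mapsto \lambda(y)(g)$ is holomorphic on $Y \times G$), a group under $(\lambda_1 \cdot \lambda_2)(y) := \lambda_1(y) \circ \lambda_2(y)$. The group $\pi$ acts on it to the right by group automorphisms via $\lambda^f := \lambda \circ f$. A crossed morphism $\varphi : \pi \to \mathrm{Maps}(Y,\mathrm{Aut}(G))$,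 $f \mapsto \varphi_f$, is a map such that $\varphi_{f_1 \circ f_2} = \varphi_{f_1}^{f_2} \cdot \varphi_{f_2}$ for all $f_1,f_2\in\pi$. The set of crossed morphisms is denoted $Z^1(\pi, \mathrm{Maps}(Y,\mathrm{Aut}(G)))$. The group $\mathrm{Maps}(Y,\mathrm{Aut}(G))$ acts on it to the left by $(\lambda \bullet \varphi)_f(y) := \lambda(f(y)) \circ \varphi_f(y) \circ \lambda(y)^{-1}$. *)

(* Defs.v *)
From HB Require Import structures.
From mathcomp Require Import all_boot all_order all_algebra.
From mathcomp Require Import all_classical all_reals all_analysis.
From mathcomp Require Import complex.
Set Implicit Arguments.
Unset Strict Implicit.
Unset Printing Implicit Defensive.
Import Order.TTheory GRing.Theory Num.Theory.
Import numFieldNormedType.Exports.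
Local Open Scope classical_set_scope.
Local Open Scope ring_scope.
Local Open Scope quotient_scope.
Local Open Scope complex_scope.

(* Complex manifolds are spaces with a structure sheaf: a complex structure on
   a topological space is the family of its holomorphic functions on open sets,
   required to be locally isomorphic to the sheaf of holomorphic functions of
   an open subset of C^n (Wells, Differential Analysis on Complex Manifolds,
   Def. I.1.1).  Products, subsets and quotients carry evident structures of
   this kind, so the underlying data are separated from the axioms:
   [hol_space], [grp_space] and [fib_space] are data, and the axioms are
   [complex_manifold], [complex_lie_group] and [group_bundle]. *)

(* The topology and norm of numFieldType's are found on a term of that type, not
   on the bare type R[i]. *)
Definition Cx (R : realType) : numFieldType := R[i].

Section HolSpaces.
Context {R : realType}.

(* Holomorphic functions of several variables are taken to be the C^1 functions
   with C-linear differential ('d is the differential over the field Cx R). *)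
Definition holomorphic_on n (D : set 'rV[Cx R]_n)
    (f : 'rV[Cx R]_n -> Cx R) :=
  forall x, D x -> differentiable f x /\
    forall v, {for x, continuous (fun y => 'd f y v)}.

(* [hol U f] means that f is holomorphic on U; it is only meaningful for open U
   and then only depends on the values of f on U. *)
Record hol_space := HolSpace {
  carrier :> topologicalType ;
  hol : set carrier -> (carrier -> Cx R) -> Prop }.

Definition is_chart (M : hol_space) n (U : set M)
    (h : M -> 'rV[Cx R]_n) (k : 'rV[Cx R]_n -> M) :=
  [/\ open U /\ open (h @` U),
      {in U, cancel h k},
      {within U, continuous h},
      {within h @` U, continuous k} &
      forall V, open V -> V `<=` U ->
        forall f, hol V f <-> holomorphic_on (h @` V) (f \o k)].

(* The dimension is locally constant; it is constant on connected manifolds and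
   on Lie groups. *)
Definition complex_manifold (M : hol_space) :=
  [/\ hausdorff_space M,
      @second_countable M,
      (forall (F : set (set M)) f, F `<=` open ->
        (hol (\bigcup_(V in F) V) f <-> forall V, F V -> hol V f)) &
      forall x : M, exists n (U : set M)
        (h : M -> 'rV[Cx R]_n) (k : 'rV[Cx R]_n -> M), is_chart U h k /\ U x].

Definition holomorphic (M N : hol_space) (f : M -> N) :=
  continuous f /\
  forall V u, open V -> hol V u -> hol (f @^-1` V) (u \o f).

Definition biholomorphic (M N : hol_space) (f : M -> N) :=
  holomorphic f /\
  exists g : N -> M, [/\ holomorphic g, cancel f g & cancel g f].

Definition prod_space (M N : hol_space) : hol_space :=
  @HolSpace (M * N)%type (fun W f =>
    forall m n U (h : M -> 'rV_m) k U' (h' : N -> 'rV_n) k',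
      is_chart U h k -> is_chart U' h' k' ->
      holomorphic_on
        ((fun z => row_mx (h z.1) (h' z.2)) @` (W `&` U `*` U'))
        (fun v => f (k (lsubmx v), k' (rsubmx v)))).

(* For A open, or A a submanifold, this is the induced complex structure. *)
Definition sub_space (M : hol_space) (A : set M) : hol_space :=
  @HolSpace (set_type A) (fun W f =>
    forall w, W w -> exists O u, [/\ open O, O (val w), hol O u &
      forall v, O (val v) -> W v -> f v = u (val v)]).

Definition quot_space (M : hol_space) (e : equiv_rel M) : hol_space :=
  @HolSpace (quotient_topology {eq_quot e}) (fun W f =>
    hol (\pi_({eq_quot e}) @^-1` W) (f \o \pi_({eq_quot e}))).

Definition in_sub T (A : set T) z (Az : A z) : set_type A :=
  exist _ z (mem_set Az).

Lemma in_subP T (A : set T) (a : set_type A) : A (val a).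
Proof. exact: set_mem (valP a). Qed.

Definition sub_map S T (A : set S) (B : set T) (f : S -> T)
    (fAB : forall z, A z -> B (f z)) (a : set_type A) : set_type B :=
  in_sub (fAB _ (in_subP a)).

Lemma holomorphic_comp (M N P : hol_space) (f : M -> N) (g : N -> P) :
  holomorphic f -> holomorphic g -> holomorphic (g \o f).
Proof.
move=> [cf hf] [cg hg]; split=> [x|V u oV hu].
  by apply: continuous_comp; [exact: cf|exact: cg].
apply: (hf (g @^-1` V) (u \o g)); last exact: hg.
by move/continuousP: cg; exact.
Qed.

Lemma biholomorphic_id (M : hol_space) : biholomorphic (@id M).
Proof.
have h : holomorphic (@id M) by split=> [x|//]; exact: cvg_id.
by split => //; exists id; split.
Qed.

Lemma biholomorphic_comp (M N P : hol_space) (f : M -> N) (g : N -> P) :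
  biholomorphic f -> biholomorphic g -> biholomorphic (g \o f).
Proof.
move=> [hf [f' [hf' ff' f'f]]] [hg [g' [hg' gg' g'g]]]; split.
  exact: holomorphic_comp.
exists (f' \o g'); split; first exact: holomorphic_comp.
- exact: can_comp.
- exact: can_comp.
Qed.

End HolSpaces.
Arguments hol_space : clear implicits.

Section LieGroups.
Context {R : realType}.

Record grp_space := GrpSpace {
  gspace :> hol_space R ;
  gmul : gspace -> gspace -> gspace }.

Definition complex_lie_group (G : grp_space) :=
  [/\ complex_manifold G,
      associative (@gmul G),
      holomorphic (fun z : prod_space G G => gmul z.1 z.2) &
      exists2 e : G, left_id e (@gmul G) /\ right_id e (@gmul G) &
      exists i : G -> G, [/\ holomorphic i,
        left_inverse e i (@gmul G) & right_inverse e i (@gmul G)]].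

Definition lie_hom (G H : grp_space) (f : G -> H) :=
  {morph f : a b / gmul a b} /\ holomorphic f.

Definition lie_iso (G H : grp_space) (f : G -> H) :=
  {morph f : a b / gmul a b} /\ biholomorphic f.

Record lie_aut (G : grp_space) := LieAut {
  aut_fun :> G -> G ;
  aut_inv : G -> G ;
  aut_hom : lie_hom aut_fun ;
  aut_inv_hom : lie_hom aut_inv ;
  aut_funK : cancel aut_fun aut_inv ;
  aut_invK : cancel aut_inv aut_fun }.

Record aut_maps (Y : hol_space R) (G : grp_space) := AutMaps {
  maps_fun :> Y -> lie_aut G ;
  maps_hol : holomorphic (fun z : prod_space Y G => maps_fun z.1 z.2 : G) }.

End LieGroups.
Arguments grp_space : clear implicits.

Section Bundles.
Context {R : realType}.

Record fib_space (X : hol_space R) := FibSpace {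
  total :> hol_space R ;
  proj : total -> X ;
  fmul : forall x, let F := sub_space (proj @^-1` [set x]) in F -> F -> F }.

Definition fibre (X : hol_space R) (E : fib_space X) (x : X) : grp_space R :=
  @GrpSpace R (sub_space (@proj X E @^-1` [set x])) (@fmul X E x).

Lemma fibre_sub (X : hol_space R) (E : fib_space X) (U : set X) y (Uy : U y)
  (z : E) : (@proj X E @^-1` [set y]) z -> (@proj X E @^-1` U) z.
Proof. by move=> /= ->. Qed.

Definition group_bundle (X : hol_space R) (E : fib_space X) :=
  [/\ complex_manifold E,
      holomorphic (@proj X E),
      forall x, complex_lie_group (fibre E x) &
      forall x, exists U, [/\ open U, U x &
        exists Phi : sub_space (@proj X E @^-1` U) ->
                     prod_space (sub_space U) (fibre E x),
        [/\ biholomorphic Phi,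
            forall z, val (Phi z).1 = proj (val z) &
            forall y (Uy : U y),
              @lie_iso R (fibre E y) (fibre E x)
                (fun a => (Phi (sub_map (fibre_sub Uy) a)).2)]]].

Definition bundle_mor (X : hol_space R) (E E' : fib_space X) (f : E -> E') :=
  holomorphic f /\
  exists hf : forall x z, (@proj X E @^-1` [set x]) z ->
                          (@proj X E' @^-1` [set x]) (f z),
    forall x, @lie_hom R (fibre E x) (fibre E' x) (sub_map (hf x)).

Definition bundle_iso (X : hol_space R) (E E' : fib_space X) :=
  exists (f : E -> E') (g : E' -> E),
    [/\ bundle_mor f, bundle_mor g, cancel f g & cancel g f].

Definition triv_bundle (Y : hol_space R) (G : grp_space R) : fib_space Y :=
  @FibSpace Y (prod_space Y G) fst (fun y a b =>
    @in_sub (Y * G) (fst @^-1` [set y])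
      (y, gmul (val a).2 (val b).2) erefl).

Section Pullback.
Variables (X Y : hol_space R) (q : Y -> X) (E : fib_space X).

Definition pull_set : set (prod_space Y E) := [set z | q z.1 = proj z.2].
Definition pull_proj (w : sub_space pull_set) : Y := (val w).1.

Lemma pull_fibreP y (a : sub_space (pull_proj @^-1` [set y])) :
  (@proj X E @^-1` [set (q y)]) (val (val a)).2.
Proof.
have ay : pull_proj (val a) = y := in_subP a.
by have az := in_subP (val a); rewrite /= -[in RHS]ay; exact/esym/az.
Qed.

Lemma pull_memP y (c : fibre E (q y)) : pull_set (y, val c).
Proof. by rewrite /pull_set /= (in_subP c). Qed.

Definition pull_mul y (a b : sub_space (pull_proj @^-1` [set y])) :
    sub_space (pull_proj @^-1` [set y]) :=
  @in_sub (sub_space pull_set) (pull_proj @^-1` [set y])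
    (in_sub (pull_memP
       (@gmul _ (fibre E (q y)) (in_sub (pull_fibreP a))
                                (in_sub (pull_fibreP b))))) erefl.

Definition pull_bundle : fib_space Y := @FibSpace Y _ pull_proj pull_mul.
End Pullback.

End Bundles.

Section Covers.
Context {R : realType}.
Variables (X Y : hol_space R) (q : Y -> X).

Definition covering :=
  holomorphic q /\
  forall x, exists U, [/\ open U, U x &
    exists S : set (set Y),
    [/\ forall V W, S V -> S W -> V `&` W !=set0 -> V = W,
        \bigcup_(V in S) V = q @^-1` U &
        forall V, S V -> open V /\
          exists hV : forall y, V y -> U (q y),
            @biholomorphic R (sub_space V) (sub_space U) (sub_map hV)]].

Record deck := Deck {
  deck_fun :> Y -> Y ;
  deck_bihol : biholomorphic deck_fun ;
  deck_over : forall y, q (deck_fun y) = q y }.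

Lemma deck_ext (f g : deck) : f =1 g -> f = g.
Proof.
case: f g => f bf qf [g bg qg] /= /funext fg.
move: bf qf; rewrite fg => bf qf.
by congr Deck; exact: Prop_irrelevance.
Qed.

Definition deck_id : deck :=
  @Deck id (biholomorphic_id Y) (fun=> erefl).

Definition deck_comp (f1 f2 : deck) : deck :=
  @Deck (f1 \o f2) (biholomorphic_comp (deck_bihol f2) (deck_bihol f1))
    (fun y => etrans (deck_over f1 (f2 y)) (deck_over f2 y)).

Lemma deck_inv (f : deck) : exists g : deck, cancel f g /\ cancel g f.
Proof.
have [hf [g [hg fg gf]]] := deck_bihol f.
have bg : biholomorphic g by split=> //; exists f.
have qg y : q (g y) = q y by rewrite -[in RHS](gf y) deck_over.
by exists (Deck bg qg).
Qed.

Definition deck_rel : rel Y := fun y y' => `[< exists f : deck, f y = y' >].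

Lemma deck_rel_equiv : equiv_class_of deck_rel.
Proof.
split.
- by move=> y; apply/asboolP; exists deck_id.
- have sym y y' : deck_rel y y' -> deck_rel y' y.
    move=> /asboolP[f <-]; have [g [fg _]] := deck_inv f.
    by apply/asboolP; exists g.
  by move=> y y'; apply/idP/idP; exact: sym.
- move=> y y' y'' /asboolP[f <-] /asboolP[g <-].
  by apply/asboolP; exists (deck_comp g f).
Qed.

Definition deck_equiv : equiv_rel Y := EquivRelPack deck_rel_equiv.

Definition deck_quot_map (z : quot_space deck_equiv) : X := q (repr z).

Definition galois_cover :=
  [/\ connected [set: Y], covering & biholomorphic deck_quot_map].

End Covers.

Section CrossedMorphisms.
Context {R : realType}.
Variables (X Y : hol_space R) (q : Y -> X) (G : grp_space R).

Record crossed := Crossed {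
  crossed_fun :> deck q -> aut_maps Y G ;
  crossedP : forall f1 f2 y,
    crossed_fun (deck_comp f1 f2) y =1 crossed_fun f1 (f2 y) \o crossed_fun f2 y
  }.

Definition maps_act (l : aut_maps Y G) (phi : crossed) (f : deck q) (y : Y)
    : G -> G :=
  l (f y) \o phi f y \o aut_inv (l y).

Definition crossed_conj (phi phi' : crossed) :=
  exists l : aut_maps Y G, forall f y, phi' f y =1 maps_act l phi f y.

Definition twist (phi : crossed) (f : deck q) (z : prod_space Y G)
    : prod_space Y G := (f z.1, phi f z.1 z.2).

Lemma twist_comp (phi : crossed) f1 f2 z :
  twist phi (deck_comp f1 f2) z = twist phi f1 (twist phi f2 z).
Proof. by rewrite /twist /= crossedP. Qed.

Lemma twist_id (phi : crossed) (f : deck q) z : f =1 id -> twist phi f z = z.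
Proof.
move=> fid; case: z => y g; rewrite /twist /= fid; congr pair.
have ff : deck_comp f f = f by apply: deck_ext => u /=; rewrite !fid.
apply: (can_inj (aut_funK (phi f y))).
by have := crossedP phi f f y g; rewrite ff /= fid => <-.
Qed.

Definition twist_rel (phi : crossed) : rel (prod_space Y G) :=
  fun z z' => `[< exists f : deck q, twist phi f z = z' >].

Lemma twist_rel_equiv (phi : crossed) : equiv_class_of (twist_rel phi).
Proof.
split.
- by move=> z; apply/asboolP; exists (deck_id q); exact: twist_id.
- have sym z z' : twist_rel phi z z' -> twist_rel phi z' z.
    move=> /asboolP[f <-]; have [g [fg _]] := deck_inv f.
    by apply/asboolP; exists g; rewrite -twist_comp twist_id.
  by move=> z z'; apply/idP/idP; exact: sym.
- move=> z z' z'' /asboolP[f <-] /asboolP[g <-].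
  by apply/asboolP; exists (deck_comp g f); rewrite twist_comp.
Qed.

Section QuotientBundle.
Variable phi : crossed.

Definition twist_equiv : equiv_rel (prod_space Y G) :=
  EquivRelPack (twist_rel_equiv phi).

Definition twist_quot : hol_space R := quot_space twist_equiv.

Definition twist_pi (z : prod_space Y G) : twist_quot :=
  \pi_({eq_quot twist_equiv}) z.

Definition twist_proj (z : twist_quot) : X := q (repr z).1.

Lemma twist_proj_pi z : twist_proj (twist_pi z) = q z.1.
Proof.
rewrite /twist_proj /twist_pi.
have /eqmodP/asboolP[f /= <-] : z = repr (\pi_({eq_quot twist_equiv}) z)
  %[mod {eq_quot twist_equiv}] by rewrite reprK.
by rewrite /= deck_over.
Qed.

(* [y, g] . [y, h] = [y, g h]: given a = [y, g], choose h with b = [y, h].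
   Such an h exists when q is Galois and b lies in the fibre of a; it is then
   unique, as the action of the deck group on Y is free. *)
Definition twist_mul (a b : twist_quot) : twist_quot :=
  let z := repr a in
  twist_pi (z.1, gmul z.2 (xget z.2 [set h | twist_pi (z.1, h) = b])).

Lemma twist_mulP a b : twist_proj (twist_mul a b) = twist_proj a.
Proof. by rewrite twist_proj_pi. Qed.

Definition twist_fmul x (a b : sub_space (twist_proj @^-1` [set x])) :
    sub_space (twist_proj @^-1` [set x]) :=
  in_sub (etrans (twist_mulP (val a) (val b)) (in_subP a)).

(* The quotient of Y x G by the deck group, viewed over X through the
   isomorphism of the quotient of Y with X. *)
Definition quot_bundle : fib_space X := @FibSpace R X _ twist_proj twist_fmul.

End QuotientBundle.

Definition piG_bundle (E : fib_space X) :=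
  group_bundle E /\ bundle_iso (pull_bundle q E) (triv_bundle Y G).

Record piG_bundle_type := PiGBundle {
  piG_fib :> fib_space X ;
  piG_bundleP : piG_bundle piG_fib }.

End CrossedMorphisms.

(* The quotient set of T by an equivalence relation r, as a type of classes;
   unlike {eq_quot _} it applies to types in a large universe without a
   choiceType structure, such as that of all bundles. *)
Definition classes T (r : T -> T -> Prop) := {A : T -> Prop | exists t, A = r t}.
Definition class_of T (r : T -> T -> Prop) (t : T) : classes r :=
  exist _ (r t) (ex_intro _ t erefl).

(* Main.v *)
Require Import Defs.
From mathcomp Require Import all_boot all_order all_algebra.
From mathcomp Require Import all_classical all_reals all_analysis.
From mathcomp Require Import complex lra.
From HB Require Import structures.
(* Required again so that [proj] and [sub_map] are those of bundles. *)
Require Import Defs.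
Local Open Scope classical_set_scope.

(** The proof has one idea and one analytic difficulty.

    The idea is to replace a (pi, G)-group bundle E by a pair of functions
    A : Y -> G -> E and B : Y -> E -> G, where A y identifies G with the fibre
    of E over q y, holomorphically in y, and B y is the inverse identification
    ([trivialized]).  Such a pair is the same thing as an isomorphism of the
    pullback of E with Y x G ([piG_trivialized], [triv_pullback_iso]), and it
    alone determines everything else.  Transporting the structure of G along
    A (s x), for a local section s of q, gives the fibres their Lie group
    structure and the bundle its local triviality ([triv_group_bundle]).
    Comparing the identifications at y and at f y, for a deck transformation
    f, gives the crossed morphism phi_f(y) = B (f y) o A y, whose cocycle
    identity is immediate because A (f y) and B (f y) cancel
    ([cocycle_exists]).  For the quotient of Y x G by phi, the pair consists of
    the projection and of the G-coordinate of a class over a given point of Y;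
    the crossed morphism obtained is phi again ([twist_trivialized],
    [twist_is_cocycle]).

    In coordinates an isomorphism E -> E' is a map l : Y -> Aut(G), and the
    map of Y x G given by such an l descends to E -> E' exactly when
    l (f y) o phi_f(y) = phi'_f(y) o l y for all f: this is the relation that
    phi and phi' are conjugate by l.  Descent is possible since deck
    transformations act transitively on the fibres of q, and the resulting map
    is holomorphic since q has local sections ([glueE], [glue_hol_map_at]).
    With l = id this identifies E with the quotient defined by its own crossed
    morphism; with general l it is the second statement, and the bijection of
    classes is a formal consequence of both.

    The difficulty is that the inverse of l must be holomorphic in y as well,
    although an element of Maps(Y, Aut(G)) is only known to be jointly
    holomorphic in the forward direction: the set Maps(Y, Aut(G)) has to be
    shown to be a group.  This is [family_inv_hol]: if the maps F(y, -) of a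
    holomorphic family are biholomorphic, then their inverses form a
    holomorphic family.  Joint continuity of the inverses is topological
    ([family_inv_continuous]).  Differentiability then follows from an inverse
    function theorem in which the inverse is already known to exist and to be
    continuous ([C1_near_inv]); after composing with the inverse of
    F(y0, -), the Jacobian is unipotent ([shear_jacobian]).

    All holomorphy is treated pointwise, by germs ([hol_near], [hol_map_at]);
    subsets such as fibres and pullbacks are handled through
    [analytic_space], which collects the properties of the structure sheaf of
    a manifold that pass to arbitrary subsets. *)

Set Implicit Arguments.
Unset Strict Implicit.
Unset Printing Implicit Defensive.
Import Order.TTheory GRing.Theory Num.Theory.
Import numFieldNormedType.Exports.
Local Open Scope ring_scope.

(** * Differential calculus in coordinates *)

Section MatrixConvergence.
Context {K : numFieldType} (T : Type) (F : set_system T) {FF : Filter F}.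

Lemma cvg_mxP m n (f : T -> 'M[K]_(m, n)) (M : 'M[K]_(m, n)) :
  f @ F --> M <-> forall i j, (fun x => f x i j) @ F --> M i j.
Proof.
split=> [fM i j|fM].
  exact: (cvg_comp _ _ fM (@coord_continuous _ _ _ i j M)).
move=> B [P MP sPB]; rewrite nbhs_simpl /=.
have : \forall x \near F, forall i j, P i j (f x i j).
  apply: filter_forall => i; apply: filter_forall => j.
  exact: (fM i j _ (MP i j)).
by apply: filterS => x Px; exact: sPB.
Qed.

Lemma cvg_mulmx m n p (f : T -> 'M[K]_(m, n)) (g : T -> 'M[K]_(n, p))
    (a : 'M[K]_(m, n)) (b : 'M[K]_(n, p)) :
  f @ F --> a -> g @ F --> b -> (fun x => f x *m g x) @ F --> a *m b.
Proof.
move=> /cvg_mxP fa /cvg_mxP gb; apply/cvg_mxP => i j.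
rewrite mxE; under eq_fun do rewrite mxE.
by apply: cvg_big => [|k _]; [exact: add_continuous|exact: cvgM].
Qed.

Lemma cvg_det n (f : T -> 'M[K]_n) (a : 'M[K]_n) :
  f @ F --> a -> (fun x => \det (f x)) @ F --> \det a.
Proof.
move=> /cvg_mxP fa; rewrite /determinant.
apply: cvg_big => [|s _]; first exact: add_continuous.
apply: cvgM; first exact: cvg_cst.
by apply: cvg_big => [|i _]; [exact: mul_continuous|exact: fa].
Qed.

Lemma cvg_invmx n (f : T -> 'M[K]_n) (a : 'M[K]_n) : a \in unitmx ->
  f @ F --> a -> (fun x => invmx (f x)) @ F --> invmx a.
Proof.
move=> ua fa; have da := cvg_det fa.
have nz : \det a != 0 by rewrite -unitfE -unitmxE.
have fu : \forall x \near F, f x \in unitmx.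
  by apply: filterS (cvgr_neq0 _ da nz) => x; rewrite unitmxE unitfE.
have -> : invmx a = (\det a)^-1 *: \adj a by rewrite /invmx ua.
apply: (@cvg_trans _ ((fun x => (\det (f x))^-1 *: \adj (f x)) @ F)).
  by apply: near_eq_cvg; apply: filterS fu => x ux; rewrite /invmx ux.
apply/cvg_mxP => i j; rewrite !mxE; under eq_fun do rewrite !mxE.
apply: cvgM; first exact: cvgV.
rewrite /cofactor; apply: cvgM; first exact: cvg_cst.
apply: cvg_det; apply/cvg_mxP => k l; rewrite !mxE.
by under eq_fun do rewrite !mxE; move/cvg_mxP: fa; exact.
Qed.

Lemma cvg_row_mx m n1 n2 (f : T -> 'M[K]_(m, n1)) (g : T -> 'M[K]_(m, n2))
    (a : 'M[K]_(m, n1)) (b : 'M[K]_(m, n2)) :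
  f @ F --> a -> g @ F --> b -> (fun x => row_mx (f x) (g x)) @ F --> row_mx a b.
Proof.
move=> /cvg_mxP fa /cvg_mxP gb; apply/cvg_mxP => i j.
rewrite mxE; under eq_fun do rewrite mxE.
by case: (fintype.split j) => k; [exact: fa|exact: gb].
Qed.

End MatrixConvergence.

Lemma continuous_eq_near (T U : topologicalType) (f g : T -> U) (x : T) :
  (\forall y \near x, f y = g y) ->
  continuous_at x f -> continuous_at x g.
Proof.
move=> fg; rewrite /continuous_at -(nbhs_singleton fg).
by apply: cvg_trans; apply: near_eq_cvg; apply: filterS fg => y ->.
Qed.

Lemma near_and (T : topologicalType) (x : T) (P Q : set T) :
  (\forall y \near x, P y) -> (\forall y \near x, Q y) ->
  \forall y \near x, P y /\ Q y.
Proof. exact: filterI. Qed.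

Lemma near_forall (T : topologicalType) (I : finType) (P : I -> set T) (x : T) :
  (forall i, \forall y \near x, P i y) -> \forall y \near x, forall i, P i y.
Proof. exact: filter_forall. Qed.

Lemma continuous_at_id (T : topologicalType) (x : T) : continuous_at x id.
Proof. exact: cvg_id. Qed.

Section MatrixContinuity.
Context {K : numFieldType} {T : topologicalType} (x : T).

Lemma continuous_add (V : normedModType K) (f g : T -> V) :
  continuous_at x f -> continuous_at x g ->
  continuous_at x (fun y => f y + g y).
Proof. exact: cvgD. Qed.

Lemma continuous_norm0 (f : T -> K) : f x = 0 ->
  (forall e, 0 < e -> \forall y \near x, `|f y| <= e) -> continuous_at x f.
Proof. by move=> fx0 H; rewrite /continuous_at fx0; apply/cvgr0Pnorm_le. Qed.

Lemma continuous_dist (f : T -> K) e : continuous_at x f -> 0 < e ->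
  \forall y \near x, `|f x - f y| <= e.
Proof. by move=> /cvgrPdist_le + e0; exact. Qed.

Lemma continuous_mxP m n (f : T -> 'M[K]_(m, n)) :
  continuous_at x f <-> forall i j, continuous_at x (fun y => f y i j).
Proof. exact: cvg_mxP. Qed.

Lemma continuous_mulmx m n p (f : T -> 'M[K]_(m, n)) (g : T -> 'M[K]_(n, p)) :
  continuous_at x f -> continuous_at x g ->
  continuous_at x (fun y => f y *m g y).
Proof. exact: cvg_mulmx. Qed.

Lemma continuous_invmx n (f : T -> 'M[K]_n) : f x \in unitmx ->
  continuous_at x f -> continuous_at x (fun y => invmx (f y)).
Proof. exact: cvg_invmx. Qed.

Lemma continuous_row_mx m n1 n2 (f : T -> 'M[K]_(m, n1)) (g : T -> 'M[K]_(m, n2)) :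
  continuous_at x f -> continuous_at x g ->
  continuous_at x (fun y => row_mx (f y) (g y)).
Proof. exact: cvg_row_mx. Qed.

Lemma near_unitmx n (f : T -> 'M[K]_n) : f x \in unitmx ->
  continuous_at x f -> \forall y \near x, f y \in unitmx.
Proof.
rewrite unitmxE unitfE => nz cf.
by apply: filterS (cvgr_neq0 _ (cvg_det cf) nz) => y; rewrite unitmxE unitfE.
Qed.

End MatrixContinuity.

Lemma continuous_center (K : numFieldType) (V : normedModType K) (x : V) :
  continuous_at x (fun y => y - x).
Proof. by apply: cvgB; [exact: cvg_id|exact: cvg_cst]. Qed.

Lemma linear_approx_diff (K : numFieldType) (V W : normedModType K) (f : V -> W)
    (df : {linear V -> W}) (x : V) : continuous df ->
  (forall e, 0 < e -> \forall y \near x,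
     `|f y - (f x + df (y - x))| <= e * `|y - x|) ->
  differentiable f x /\ 'd f x = df :> (V -> W).
Proof.
move=> cdf fdf.
have fL : f \o shift x = cst (f x) + df +o_ 0 id.
  apply/eqaddoP => e e0.
  suff : \forall h \near (0 : V), `|f (h + x) - (f x + df h)| <= e * `|h| by [].
  rewrite (near_shift x) sub0r; apply: filterS (fdf e e0) => y /=.
  by rewrite subrK.
have dE := diff_unique cdf fL.
by split=> //; apply/diff_locallyP; rewrite dE.
Qed.

Lemma ler_norm_entry (K : numFieldType) m n (M : 'M[K]_(m, n)) i j :
  `|M i j| <= `|M|.
Proof.
rewrite [leRHS]mx_normE -[leLHS]nngE num_le.
exact: (le_bigmax _ (fun ij : 'I_m * 'I_n => `|M ij.1 ij.2|%:nng) (i, j)).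
Qed.

Section Jacobian.
Context {K : numFieldType}.

(** The Jacobian in Caratheodory's form: the difference quotient is an exact
    matrix product whose factor A is continuous at x.  Chain rule and inverse
    function theorem then become matrix algebra plus continuity, with no
    estimates. *)
Definition has_jac n m (f : 'rV[K]_n -> 'rV[K]_m) (x : 'rV[K]_n)
    (J : 'M[K]_(n, m)) :=
  exists A : 'rV[K]_n -> 'M[K]_(n, m),
    [/\ continuous_at x A, A x = J &
        \forall y \near x, f y - f x = (y - x) *m A y].

Lemma has_jac_continuous n m (f : 'rV[K]_n -> 'rV[K]_m) (x : 'rV[K]_n) J :
  has_jac f x J -> continuous_at x f.
Proof.
move=> [A [cA _ fA]].
have h := continuous_add (@cst_continuous _ _ (f x) x)
  (continuous_mulmx (@continuous_center _ _ x) cA).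
apply: continuous_eq_near h.
by apply: filterS fA => y fy; rewrite -[RHS](subrK (f x)) fy addrC.
Qed.

Lemma has_jac_near n m (f g : 'rV[K]_n -> 'rV[K]_m) (x : 'rV[K]_n) J :
  (\forall y \near x, f y = g y) -> has_jac f x J -> has_jac g x J.
Proof.
move=> fg [A [cA AJ fA]]; exists A; split; [by []|by []|].
have fgx := nbhs_singleton fg.
by apply: filterS2 fg fA => y; rewrite fgx => ->.
Qed.

Lemma has_jac_comp n m p (f : 'rV[K]_n -> 'rV[K]_m) (g : 'rV[K]_m -> 'rV[K]_p)
    (x : 'rV[K]_n) J J' :
  has_jac f x J -> has_jac g (f x) J' -> has_jac (g \o f) x (J *m J').
Proof.
move=> jf [B [cB <- gB]]; have cf := has_jac_continuous jf.
case: jf => A [cA <- fA]; exists (fun y => A y *m B (f y)); split; [|by []|].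
  by apply: continuous_mulmx; [exact: cA|exact: (continuous_comp cf cB)].
by apply: filterS2 fA (cf _ gB) => y fy gy /=; rewrite gy fy mulmxA.
Qed.

Lemma has_jac_mulmx n m (L : 'M[K]_(n, m)) (x : 'rV[K]_n) :
  has_jac (mulmx^~ L) x L.
Proof.
exists (fun=> L); split; [exact: cst_continuous|by []|].
by near=> y; rewrite mulmxBl.
Unshelve. all: by end_near. Qed.

Lemma has_jac_cst n m (c : 'rV[K]_m) (x : 'rV[K]_n) : has_jac (fun=> c) x 0.
Proof.
exists (fun=> 0); split; [exact: cst_continuous|by []|].
by near=> y; rewrite subrr mulmx0.
Unshelve. all: by end_near. Qed.

Lemma has_jac_coordP n m (f : 'rV[K]_n -> 'rV[K]_m) (x : 'rV[K]_n) J :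
  has_jac f x J <->
  forall j, has_jac (fun y => (f y 0 j)%:M : 'rV_1) x (col j J).
Proof.
split=> [[A [/continuous_mxP cA <- fA]] j|].
  exists (fun y => col j (A y)); split; [|by []|].
    by apply/continuous_mxP => i k; under eq_fun do rewrite mxE; exact: cA.
  apply: filterS fA => y fy; apply/rowP => k; rewrite !mxE ord1 !mulr1n.
  transitivity ((f y - f x) 0 j); first by rewrite !mxE.
  by rewrite fy !mxE; apply: eq_bigr => i _; rewrite !mxE.
move=> /choice[A AP].
exists (fun y => \matrix_(i, j) A j y i 0); split.
- apply/continuous_mxP => i j; under eq_fun do rewrite mxE.
  by have [/continuous_mxP + _ _] := AP j; exact.
- by apply/matrixP => i j; have [_ Aj _] := AP j; rewrite mxE Aj mxE.
- have : \forall y \near x, forall j,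
      (f y 0 j)%:M - (f x 0 j)%:M = (y - x) *m A j y :> 'rV[K]_1.
    by apply: near_forall => j; have [] := AP j.
  apply: filterS => y Ay; apply/rowP => j.
  have /rowP/(_ 0) := Ay j; rewrite !mxE !mulr1n => ->.
  by apply: eq_bigr => i _; rewrite !mxE.
Qed.

Definition grad n (f : 'rV[K]_n -> K) (x : 'rV[K]_n) : 'cV[K]_n :=
  \col_i 'd f x (delta_mx 0 i).

Lemma diff_grad n (f : 'rV[K]_n ->
    K) (x : 'rV[K]_n) v : 'd f x v = (v *m grad f x) 0 0.
Proof.
rewrite [in LHS](row_sum_delta v) linear_sum mxE; apply: eq_bigr => i _.
by rewrite linearZ !mxE.
Qed.

(** The remainder of a differentiable function is absorbed into one entry of
    the Caratheodory factor: the entry of a coordinate i at which |y - x| is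
    attained, where the remainder divided by (y - x)_i is small. *)
Lemma differentiable_jac n (f : 'rV[K]_n ->
    K) (x : 'rV[K]_n) : differentiable f x ->
  has_jac (fun y => (f y)%:M : 'rV_1) x (grad f x).
Proof.
move=> df; pose rem y := f y - f x - 'd f x (y - x).
pose P (v : 'rV[K]_n) (o : option 'I_n) :=
  if o is Some i then `|v| = `|v 0 i| /\ v 0 i != 0 else v = 0.
have [|idx idxP] := @choice _ _ P.
  move=> v; have [->|vn0] := eqVneq v 0; first by exists None.
  have vn : mx_norm v != 0 by apply: contra vn0 => /eqP/mx_norm_eq0->.
  have [[i j] /= vij] := mx_norm_neq0 vn.
  exists (Some j); rewrite /= -(ord1 i) -normr_eq0 -vij; split => //.
pose c y i : K := if idx (y - x) == Some i then rem y / (y - x) 0 i else 0.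
have c0 i : c x i = 0 by rewrite /c; case: ifP => // _;
  rewrite subrr mxE invr0 mulr0.
exists (fun y => grad f x + \col_i c y i); split.
- apply: continuous_add; first exact: cst_continuous.
  apply/continuous_mxP => i j; under eq_fun do rewrite mxE.
  apply: continuous_norm0 => // e e0.
  have ry : \forall h \near (0 : 'rV[K]_n),
      `|(f \o shift x - (cst (f x) + 'd f x)) h| <= e * `|h|.
    by have [_ /eqaddoP/(_ e e0)] := (diff_locallyP x f).1 df.
  rewrite (near_shift x) sub0r in ry.
  apply: filterS ry => y /= ry.
  rewrite /c; case: eqP => [yi|_]; last by rewrite normr0 ltW.
  have := idxP (y - x); rewrite yi => -[nyi nz].
  rewrite normrM normfV ler_pdivrMr ?normr_gt0// -nyi.
  move: ry.
  have -> : (f \o shift x - (cst (f x) + 'd f x)) (y - x) = rem y.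
    transitivity (f (y - x + x) - (f x + 'd f x (y - x))); first by [].
    by rewrite subrK opprD addrA.
  by [].
- by rewrite -[RHS]addr0; congr (_ + _); apply/colP => i; rewrite !mxE c0.
near=> y; rewrite mulmxDr; apply/rowP => j.
rewrite ord1 [RHS]mxE -diff_grad [X in _ = _ + X]mxE.
transitivity (f y - f x); first by rewrite !mxE !mulr1n.
transitivity ('d f x (y - x) + rem y); first by rewrite /rem [RHS]addrC subrK.
congr (_ + _).
have := idxP (y - x); case yi : (idx (y - x)) => [i|].
  move=> [_ nz]; rewrite (bigD1 i)//= [X in _ * X]mxE /c yi eqxx mulrCA divff//
    mulr1.
  rewrite big1 ?addr0// => k ki; rewrite [X in _ * X]mxE /c ?yi.
  by case: eqP => [[ik]|]; [rewrite ik eqxx in ki|rewrite mulr0].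
move=> yx; rewrite big1 => [|k _]; last by rewrite [X in _ * X]mxE /c ?yi mulr0.
by rewrite /rem yx linear0 subr0 -{1}(subrK x y) yx add0r subrr.
Unshelve. all: by end_near. Qed.

Lemma jac_differentiable n (f : 'rV[K]_n -> K) (x : 'rV[K]_n) J :
  has_jac (fun y => (f y)%:M : 'rV_1) x J ->
  differentiable f x /\ forall v, 'd f x v = (v *m J) 0 0.
Proof.
move=> [A [cA AJ fA]].
pose L := fun v : 'rV[K]_n => (v *m J) 0 0.
have Llin : linear L by move=> a u v; rewrite /L mulmxDl -scalemxAl !mxE.
pose lM := GRing.isLinear.Build _ _ _ _ L Llin.
pose dL : {linear 'rV[K]_n -> K} := HB.pack L lM.
have cL : continuous dL.
  move=> v; have cv : continuous_at v (fun w : 'rV[K]_n => w *m J).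
    by apply: continuous_mulmx; [exact: continuous_at_id|exact: cst_continuous].
  by move/continuous_mxP : cv; exact.
have [|D dE] := @linear_approx_diff _ _ _ f dL x cL; last first.
- by split => // v; rewrite dE.
- move=> e e0; have n0 : 0 < n.+1%:R :> K by rewrite ltr0n.
  have Ax : \forall y \near x, forall i, `|A x i 0 - A y i 0| <= e / n.+1%:R.
    apply: near_forall => i; apply: continuous_dist; last exact: divr_gt0.
    by move/continuous_mxP : cA; exact.
  apply: filterS2 fA Ax => y fy Ay; rewrite /= /L.
  have -> : f y - (f x + ((y - x) *m J) 0 0) =
      \sum_i (y - x) 0 i * (A y i 0 - A x i 0).
    have /matrixP/(_ 0 0) := fy; rewrite [LHS]mxE [X in X + _]mxE [X in _ + X]mxE.
    rewrite [X in - X]mxE !mulr1n opprD addrA => ->.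
    rewrite -AJ !mxE -sumrB.
    by apply: eq_bigr => i _; rewrite mulrBr.
  apply: le_trans (ler_norm_sum _ _ _) _.
  apply: (@le_trans _ _ (\sum_(i < n) (e / n.+1%:R) * `|y - x|)).
    apply: ler_sum => i _; rewrite normrM mulrC ler_pM//.
      by rewrite distrC; exact: Ay.
    exact: ler_norm_entry.
  rewrite sumr_const card_ord -[leLHS]mulr_natl mulrA ler_wpM2r// mulrCA.
  apply: ler_piMr; first exact: ltW.
  by rewrite ler_pdivrMr// mul1r ler_nat.
Qed.

(** The condition required by [holomorphic_on] at each point. *)
Definition C1_at n (f : 'rV[K]_n -> K) (x : 'rV[K]_n) :=
  differentiable f x /\ forall v, {for x, continuous (fun y => 'd f y v)}.

Definition C1_near n m (f : 'rV[K]_n -> 'rV[K]_m) (x : 'rV[K]_n) :=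
  \forall y \near x, forall j, C1_at (fun z => f z 0 j) y.

(** Passage between partial derivatives and Jacobians; stated near x because
    a Jacobian that is continuous at x presupposes differentiability around x. *)
Lemma C1_nearP n m (f : 'rV[K]_n -> 'rV[K]_m) (x : 'rV[K]_n) :
  C1_near f x <-> exists J : 'rV[K]_n -> 'M[K]_(n, m),
    \forall y \near x, continuous_at y J /\ has_jac f y (J y).
Proof.
split=> [fx|[J Jx]].
  exists (fun y => \matrix_(i, j) 'd (fun z => f z 0 j) y (delta_mx 0 i)).
  apply: filterS fx => y fy; split.
    apply/continuous_mxP => i j; under eq_fun do rewrite mxE.
    by have [_] := fy j; exact.
  apply/has_jac_coordP => j.
  have [/differentiable_jac + _] := fy j.
  by congr has_jac; apply/colP => i; rewrite !mxE.
move/near_join : Jx; apply: filterS => y Jy j.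
have Jd z : continuous_at z J /\ has_jac f z (J z) ->
    differentiable (fun w => f w 0 j) z /\
    forall v, 'd (fun w => f w 0 j) z v = (v *m col j (J z)) 0 0.
  by move=> [_ /has_jac_coordP/(_ j)/jac_differentiable].
have Jyy := nbhs_singleton Jy; split; first by have [] := Jd y Jyy.
move=> v; have h : continuous_at y (fun z => (v *m col j (J z)) 0 0).
  have /continuous_mxP : continuous_at y (fun z => v *m col j (J z)).
    apply: continuous_mulmx; first exact: cst_continuous.
    apply/continuous_mxP => i k; under eq_fun do rewrite mxE.
    by have [/continuous_mxP + _] := Jyy; exact.
  exact.
suff : continuous_at y (fun z => 'd (fun w => f w 0 j) z v) by [].
apply: continuous_eq_near h.
by apply: filterS Jy => z /Jd[_ ->].
Qed.

Lemma C1_near_continuous n m (f : 'rV[K]_n -> 'rV[K]_m) (x : 'rV[K]_n) :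
  C1_near f x -> continuous_at x f.
Proof.
by move=> /C1_nearP[J /nbhs_singleton[_ /has_jac_continuous]].
Qed.

Lemma C1_near_eq n m (f g : 'rV[K]_n -> 'rV[K]_m) (x : 'rV[K]_n) :
  (\forall y \near x, f y = g y) -> C1_near f x -> C1_near g x.
Proof.
move=> /near_join fg /C1_nearP[J Jx]; apply/C1_nearP; exists J.
by apply: filterS2 fg Jx => y fgy [cJ fJ]; split=> //; exact: has_jac_near fJ.
Qed.

Lemma C1_near_comp n m p (f : 'rV[K]_n -> 'rV[K]_m) (g : 'rV[K]_m -> 'rV[K]_p)
    (x : 'rV[K]_n) :
  C1_near f x -> C1_near g (f x) -> C1_near (g \o f) x.
Proof.
move=> fx; have cf := C1_near_continuous fx.
move: fx => /C1_nearP[J Jx] /C1_nearP[J' Jfx]; apply/C1_nearP.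
exists (fun y => J y *m J' (f y)); apply: filterS2 Jx (cf _ Jfx).
move=> y [cJ fJ] [cJ' gJ']; split; last exact: has_jac_comp.
apply: continuous_mulmx; first exact: cJ.
exact: (continuous_comp (has_jac_continuous fJ) cJ').
Qed.

Lemma C1_near_mulmx n m (L : 'M[K]_(n, m)) (x : 'rV[K]_n) :
  C1_near (mulmx^~ L) x.
Proof.
apply/C1_nearP; exists (fun=> L); near=> y.
by split; [exact: cst_continuous|exact: has_jac_mulmx].
Unshelve. all: by end_near. Qed.

(** With f in Caratheodory's form, f (g z) = z reads
    z - y = (g z - g y) A(g z); near y the square matrix A(g z) L is close to
    J L = 1, hence invertible, so g z - g y = (z - y) L (A(g z) L)^-1. *)
Lemma has_jac_inv n m (f : 'rV[K]_n -> 'rV[K]_m) (g : 'rV[K]_m -> 'rV[K]_n)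
    (y : 'rV[K]_m) J (L : 'M[K]_(m, n)) :
  continuous_at y g -> (\forall z \near y, f (g z) = z) ->
  has_jac f (g y) J -> J *m L = 1%:M -> has_jac g y L.
Proof.
move=> cg gK [A [cA AJ fA]] JL.
have cAL : continuous_at y (fun z => A (g z) *m L).
  apply: continuous_mulmx; last exact: cst_continuous.
  exact: (continuous_comp cg cA).
have u1 : A (g y) *m L \in unitmx by rewrite AJ JL unitmx1.
exists (fun z => L *m invmx (A (g z) *m L)); split.
- by apply: continuous_mulmx; [exact: cst_continuous|exact: continuous_invmx].
- by rewrite AJ JL invmx1 mulmx1.
have gKy := nbhs_singleton gK.
have uA := @near_unitmx _ _ y _ (fun z => A (g z) *m L) u1 cAL.
apply: filterS2 (near_and gK uA) (cg _ fA) => z [gKz uz] /=.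
rewrite gKz gKy => fz.
by rewrite mulmxA fz -(mulmxA _ _ L) -mulmxA mulmxV// mulmx1.
Qed.

(** Inverse function theorem for an inverse that is known to exist and to be
    continuous.  Only a right inverse L of the Jacobian at the one point g y is
    needed: J(g z) L remains invertible for z near y. *)
Lemma C1_near_inv n m (f : 'rV[K]_n -> 'rV[K]_m) (g : 'rV[K]_m -> 'rV[K]_n)
    (y : 'rV[K]_m) (L : 'M[K]_(m, n)) :
  (\forall z \near y, continuous_at z g) -> (\forall z \near y, f (g z) = z) ->
  C1_near f (g y) -> (forall J, has_jac f (g y) J -> J *m L = 1%:M) ->
  C1_near g y.
Proof.
move=> cg gK /C1_nearP[J Jgy] JL; apply/C1_nearP.
have cgy : continuous_at y g := nbhs_singleton cg.
have [cJ fJ] := nbhs_singleton Jgy.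
have cJL : continuous_at y (fun z => J (g z) *m L).
  apply: continuous_mulmx; last exact: cst_continuous.
  exact: (continuous_comp cgy cJ).
have u1 : J (g y) *m L \in unitmx by rewrite JL// unitmx1.
exists (fun z => L *m invmx (J (g z) *m L)).
have H := near_and (near_join gK) (@near_unitmx _ _ y _ (fun z => J
  (g z) *m L) u1 cJL).
have {}H := near_and H cg.
apply: filterS2 H (cgy _ Jgy) => z [[gKz uz] cgz] /= [cJz fJz]; split.
  apply: continuous_mulmx; first exact: cst_continuous.
  apply: continuous_invmx => //.
  apply: continuous_mulmx; last exact: cst_continuous.
  exact: (continuous_comp cgz cJz).
by apply: has_jac_inv gKz fJz _ => //; rewrite mulmxA mulmxV.
Qed.

Lemma C1_near_entries n m p (f : 'rV[K]_n -> 'rV[K]_m) (g : 'rV[K]_n -> 'rV[K]_p)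
    (s : 'I_p -> 'I_m) (x : 'rV[K]_n) :
  (forall v j, g v 0 j = f v 0 (s j)) -> C1_near f x -> C1_near g x.
Proof.
move=> fg; apply: filterS => y fy j.
have -> : (fun z => g z 0 j) = (fun z => f z 0 (s j)) by apply/funext => z.
exact: fy.
Qed.

Lemma C1_near_id n (x : 'rV[K]_n) : C1_near id x.
Proof.
have := C1_near_mulmx (1%:M) x; apply: C1_near_eq.
by near=> y; rewrite mulmx1.
Unshelve. all: by end_near. Qed.

Lemma C1_near_lsubmx n1 n2 (x : 'rV[K]_(n1 + n2)) : C1_near (@lsubmx _ 1 n1 n2) x.
Proof.
by apply: (@C1_near_entries _ _ _ id _ (lshift n2)); [move=> v j;
  rewrite mxE|exact: C1_near_id].
Qed.

Lemma C1_near_rsubmx n1 n2 (x : 'rV[K]_(n1 + n2)) : C1_near (@rsubmx _ 1 n1 n2) x.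
Proof.
by apply: (@C1_near_entries _ _ _ id _ (@rshift n1 n2)); [move=> v j;
  rewrite mxE|exact: C1_near_id].
Qed.

Lemma C1_near_row_mx n m1 m2 (f : 'rV[K]_n -> 'rV[K]_m1) (g : 'rV[K]_n -> 'rV[K]_m2)
    (x : 'rV[K]_n) :
  C1_near f x -> C1_near g x -> C1_near (fun v => row_mx (f v) (g v)) x.
Proof.
move=> fx gx; apply: filterS2 fx gx => y fy gy j.
case: (fintype.splitP j) => i ji.
  have -> : (fun z => row_mx (f z) (g z) 0 j) = (fun z => f z 0 i).
    by apply/funext => z; rewrite (_ : j = lshift m2 i) ?row_mxEl//; exact/val_inj.
  exact: fy.
have -> : (fun z => row_mx (f z) (g z) 0 j) = (fun z => g z 0 i).
  by apply/funext => z; rewrite (_ : j = rshift m1 i) ?row_mxEr//; exact/val_inj.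
exact: gy.
Qed.

End Jacobian.

(** * Germs of holomorphic functions and maps *)

Lemma near_open (T : topologicalType) (P : set T) (x : T) :
  (\forall y \near x, P y) <-> exists O, [/\ open O, O x & O `<=` P].
Proof.
rewrite /prop_near1 nbhsE; split; first by case=> O [oO Ox] OP; exists O.
by case=> O [oO Ox OP]; exists O.
Qed.

Lemma open_near (T : topologicalType) (O : set T) (x : T) :
  open O -> O x -> \forall y \near x, O y.
Proof. by move=> oO Ox; apply: open_nbhs_nbhs. Qed.

Lemma open_pointwise (T : topologicalType) (O : set T) :
  (forall x, O x -> \forall y \near x, O y) -> open O.
Proof. by rewrite openE. Qed.

Lemma continuous_within_open (T U : topologicalType) (A : set T) (f : T -> U)
    (x : T) :
  open A -> {within A, continuous f} -> A x -> continuous_at x f.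
Proof.
move=> oA /subspace_continuousP cf Ax; have := cf x Ax.
rewrite within_interior //; exact: open_nbhs_nbhs.
Qed.

Section Germs.
Context {R : realType}.
Local Notation C := (Cx R).

Lemma C1_near_scalar n (u : 'rV[C]_n -> C) (x : 'rV[C]_n) :
  C1_near (fun v => (u v)%:M : 'rV_1) x <-> \forall y \near x, C1_at u y.
Proof.
have e : (fun v => ((u v)%:M : 'M[C]_1) 0 0) = u.
  by apply/funext => v; rewrite mxE mulr1n.
split; apply: filterS => y; first by move/(_ 0); rewrite e.
by move=> uy j; rewrite ord1 e.
Qed.

Definition hol_near (M : hol_space R) (f : M -> C) (x : M) :=
  exists O, [/\ open O, O x & hol O f].

(** Holomorphy of a map at a point, tested on germs of functions.  Unlike
    [holomorphic] it is local and composes pointwise, which allows maps given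
    by different formulas, or by arbitrary values, away from the point. *)
Definition hol_map_at (M N : hol_space R) (f : M -> N) (x : M) :=
  continuous_at x f /\ forall u, hol_near u (f x) -> hol_near (u \o f) x.

Definition sheaf (M : hol_space R) := forall (F : set (set M)) f, F `<=` open ->
  (hol (\bigcup_(V in F) V) f <-> forall V, F V -> hol V f).

(** What survives on an arbitrary subset of a manifold: a sheaf of functions,
    determined by their values, and stable under substitution into
    holomorphic functions of several variables. *)
Definition analytic_space (M : hol_space R) :=
  [/\ sheaf M,
      (forall f g (x : M), (\forall y \near x, f y = g y) -> hol_near f x ->
        hol_near g x) &
      forall n (f : M -> 'rV[C]_n) (u : 'rV[C]_n -> 'rV[C]_1) (x : M),
        (forall j, hol_near (fun y => f y 0 j) x) -> C1_near u (f x) ->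
        hol_near (fun y => u (f y) 0 0) x].

Lemma sheaf_sub (M : hol_space R) (U V : set M) f :
  sheaf M -> open U -> open V -> V `<=` U -> hol U f -> hol V f.
Proof.
move=> sM oU oV VU hU; pose F : set (set M) := [set U; V].
have oF : F `<=` open by move=> W [->|->].
have FU : \bigcup_(W in F) W = U.
  apply/seteqP; split=> [x [W [->|->]//]|x Ux]; first exact: VU.
  by exists U => //; left.
by have [+ _] := sM F f oF; rewrite FU => /(_ hU); apply; right.
Qed.

Lemma sheaf_hol_near (M : hol_space R) (U : set M) f : sheaf M -> open U ->
  (hol U f <-> forall x, U x -> hol_near f x).
Proof.
move=> sM oU; split=> [hU x Ux|hU]; first by exists U.
pose F : set (set M) := [set V | [/\ open V, V `<=` U & hol V f]].
have oF : F `<=` open by move=> V [].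
have -> : U = \bigcup_(V in F) V.
  apply/seteqP; split=> [x Ux|x [V [_ VU _] /VU//]].
  have [ O [oO Ox hO]] := hU x Ux; exists (O `&` U) => //; split.
  - exact: openI.
  - by move=> y [].
  - by apply: (sheaf_sub sM oO (openI oO oU) _ hO) => y [].
by apply/(sM F f oF) => V [].
Qed.

Lemma hol_map_at_comp (M N P : hol_space R) (f : M -> N) (g : N -> P) x :
  hol_map_at f x -> hol_map_at g (f x) -> hol_map_at (g \o f) x.
Proof.
move=> [cf hf] [cg hg]; split; first exact: continuous_comp cf cg.
by move=> u hu; apply: (hf (u \o g)); exact: hg.
Qed.

Lemma hol_map_at_id (M : hol_space R) (x : M) : hol_map_at id x.
Proof. by split=> //; exact: continuous_at_id. Qed.

Lemma hol_map_at_eq (M N : hol_space R) (f g : M -> N) x : analytic_space M ->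
  (\forall y \near x, f y = g y) -> hol_map_at f x -> hol_map_at g x.
Proof.
move=> [_ eM _] fg [cf hf]; split; first exact: continuous_eq_near cf.
move=> u; rewrite -(nbhs_singleton fg) => /hf; apply: eM.
by apply: filterS fg => y /= ->.
Qed.

Lemma holomorphicP (M N : hol_space R) (f : M -> N) : sheaf M ->
  (holomorphic f <-> forall x, hol_map_at f x).
Proof.
move=> sM; split=> [[cf hf] x|hf].
  split=> [|u [V [oV Vfx hV]]]; first exact: cf.
  exists (f @^-1` V); split=> //; last exact: hf.
  by move/continuousP : cf; exact.
have cf : continuous f by move=> x; have [] := hf x.
split=> // V u oV hV; apply/sheaf_hol_near => //.
  by move/continuousP : cf; exact.
by move=> x Vfx; have [_] := hf x; apply; exists V.
Qed.

Lemma analytic_sheaf (M : hol_space R) : analytic_space M -> sheaf M.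
Proof. by case. Qed.

Section Chart.
Variables (M : hol_space R) (sM : sheaf M) (n : nat) (U : set M).
Variables (h : M -> 'rV[C]_n) (k : 'rV[C]_n -> M) (ch : is_chart U h k).

Lemma chart_open : open U. Proof. by case: ch => -[]. Qed.
Lemma chart_openI : open (h @` U). Proof. by case: ch => -[]. Qed.
Lemma chartK x : U x -> k (h x) = x.
Proof. by move=> Ux; case: ch => _ hK _ _ _; rewrite hK// inE. Qed.
Lemma chart_cont x : U x -> continuous_at x h.
Proof.
by move=> Ux; case: ch => -[oU _] _ ch' _ _; exact: continuous_within_open Ux.
Qed.
Lemma chart_contV v : (h @` U) v -> continuous_at v k.
Proof.
by move=> hv; case: ch => -[_ oU] _ _ ch' _; exact: continuous_within_open hv.
Qed.
Lemma chart_invK v : (h @` U) v -> h (k v) = v /\ U (k v).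
Proof. by move=> [x Ux <-]; rewrite chartK. Qed.

Lemma chart_hol_near (f : M -> C) x : U x ->
  hol_near f x <-> \forall v \near h x, C1_at (f \o k) v.
Proof.
move=> Ux; have hUx : (h @` U) (h x) by exists x.
have ckx := chart_contV hUx.
case: (ch) => _ _ _ _ holU; split.
  move=> [ O [oO Ox hO]].
  have oV : open (O `&` U) by apply: openI => //; exact: chart_open.
  have hV : hol (O `&` U) f by apply: (sheaf_sub sM oO oV _ hO) => y [].
  have OU : O `&` U `<=` U by move=> y [].
  have [/(_ hV) hf _] := holU _ oV OU f.
  have kO : \forall v \near h x, O (k v).
    by apply: ckx; rewrite chartK//; exact: open_near.
  apply: filterS2 (open_near chart_openI hUx) kO => v hUv Okv.
  have [hkv Ukv] := chart_invK hUv.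
  by apply: hf; exists (k v).
move=> /near_open[D [oD Dhx DC]].
have := chart_cont Ux (open_near oD Dhx).
move=> /(near_and (open_near chart_open Ux))/near_open[V [oV Vx VUD]].
have VU : V `<=` U by move=> y /VUD[].
exists V; split; [exact: oV|exact: Vx|].
have [_] := holU V oV VU f; apply.
by move=> _ [y /VUD[_ Dy] <-]; exact: DC.
Qed.

End Chart.

Lemma manifold_sheaf (M : hol_space R) : complex_manifold M -> sheaf M.
Proof. by case. Qed.

(** Both properties are read in a chart, where they are locality of the
    derivative and the chain rule. *)
Lemma manifold_analytic (M : hol_space R) : complex_manifold M -> analytic_space M.
Proof.
move=> mM; have sM := manifold_sheaf mM; case: mM => _ _ _ charts.
split => // [f g x fg|n f u x fx ux].
  have [n [U [h [k [ch Ux]]]]] := charts x.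
  have hUx : (h @` U) (h x) by exists x.
  move=> /(chart_hol_near sM ch _ Ux)/C1_near_scalar fx.
  apply/(chart_hol_near sM ch _ Ux)/C1_near_scalar; apply: C1_near_eq fx.
  have := chart_contV ch hUx; rewrite /continuous_at (chartK ch Ux) => /(_ _ fg) h'.
  have {}h' : \forall v \near h x, f (k v) = g (k v) := h'.
  by apply: filterS h' => v /= ->.
have [m [U [h [k [ch Ux]]]]] := charts x.
apply/(chart_hol_near sM ch _ Ux).
have fk : C1_near (f \o k) (h x).
  apply: near_forall => j; have [+ _] := chart_hol_near sM ch (fun y => f y 0 j) Ux.
  by apply.
have := C1_near_comp fk; rewrite /= (chartK ch Ux) => /(_ _ _ ux).
by apply: filterS => v /(_ 0).
Qed.

End Germs.

(** * Charts and subspaces *)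

Section Constructions.
Context {R : realType}.
Local Notation C := (Cx R).

(** A chart may be checked on germs: the condition on each open V follows
    from the sheaf property. *)
Lemma is_chart_intro (M : hol_space R) n (U : set M) (h : M -> 'rV[C]_n)
    (k : 'rV[C]_n -> M) :
  sheaf M -> open U -> open (h @` U) -> (forall x, U x -> k (h x) = x) ->
  (forall x, U x -> continuous_at x h) ->
  (forall v, (h @` U) v -> continuous_at v k) ->
  (forall f x, U x -> hol_near f x <-> \forall v \near h x, C1_at (f \o k) v) ->
  is_chart U h k.
Proof.
move=> sM oU ohU hK ch ck hP; split.
- by [].
- by move=> x /set_mem; exact: hK.
- by apply: continuous_in_subspaceT => x /set_mem; exact: ch.
- by apply: continuous_in_subspaceT => v /set_mem; exact: ck.
- move=> V oV VU f; split.
    move=> hV _ [x Vx <-].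
    have [+ _] := hP f x (VU x Vx) => /(_ _)/wrap[|H]; first by exists V.
    exact: nbhs_singleton H.
  move=> hV; apply/(sheaf_hol_near f sM oV) => x Vx.
  have [_] := hP f x (VU x Vx); apply.
  have ckx : continuous_at (h x) k by apply: ck; exists x; [exact: VU|].
  have kV : \forall v \near h x, V (k v).
    by have := ckx V; rewrite hK; [apply; exact: open_near|exact: VU].
  have hUx : (h @` U) (h x) by exists x; [exact: VU|].
  apply: filterS2 kV (open_near ohU hUx) => v Vkv [y Uy yv].
  by apply: hV; exists (k v) => //; rewrite -yv hK.
Qed.

(** Charts descend along a local isomorphism p with local inverse s.  This
    single construction serves open subspaces, transport along biholomorphic
    maps and quotients by a properly discontinuous action; p and s may take
    arbitrary values outside W and its image. *)
Lemma chart_push (M Q : hol_space R) (p : M -> Q) (s : Q ->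
    M) (W : set M) (x0 : M) :
  complex_manifold M -> sheaf Q ->
  (forall f g (y : Q), (\forall z \near y, f z = g z) -> hol_near f y ->
    hol_near g y) ->
  open W -> W x0 ->
  (forall O, open O -> O `<=` W -> open (p @` O)) ->
  (forall x, W x -> s (p x) = x) ->
  (forall x, W x -> hol_map_at p x) -> (forall x, W x -> hol_map_at s (p x)) ->
  exists n U (h : Q -> 'rV[C]_n) (k : 'rV[C]_n -> Q), is_chart U h k /\ U (p x0).
Proof.
move=> mM sQ eQ oW Wx0 op sK hp hs; have sM := manifold_sheaf mM.
case: (mM) => _ _ _ charts; have [n [U [h [k [ch Ux0]]]]] := charts x0.
have oU := chart_open ch.
exists n, (p @` (W `&` U)), (h \o s), (p \o k); split; last by exists x0.
have hsp x : W x -> h (s (p x)) = h x by move=> Wx; rewrite sK.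
apply: is_chart_intro => //.
- by apply: op; [exact: openI|move=> x []].
- have -> : (h \o s) @` (p @` (W `&` U)) = h @` (W `&` U).
    apply/seteqP; split=> [_ [_ [x [Wx Ux] <-] <-]|_ [x [Wx Ux] <-]] /=.
      by rewrite (sK _ Wx); exists x.
    by exists (p x); [exists x|rewrite /= (sK _ Wx)].
  apply: open_pointwise => _ [x [Wx Ux] <-].
  have hUx : (h @` U) (h x) by exists x.
  have := chart_contV ch hUx; rewrite /continuous_at (chartK ch Ux).
  move=> /(_ _ (open_near (openI oW oU) (conj Wx Ux))) H.
  have {}H : \forall v \near h x, (W `&` U) (k v) := H.
  apply: filterS2 H (open_near (chart_openI ch) hUx) => v WUkv hUv.
  by have [hkv _] := chart_invK ch hUv; exists (k v).
- by move=> _ [x [Wx Ux] <-] /=; rewrite (sK _ Wx) (chartK ch).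
- move=> _ [x [Wx Ux] <-]; apply: continuous_comp; first by have [] := hs x Wx.
  by rewrite (sK _ Wx); exact: (chart_cont ch Ux).
- move=> _ [_ [x [Wx Ux] <-] <-] /=; rewrite (sK _ Wx).
  have hUx : (h @` U) (h x) by exists x.
  apply: continuous_comp; first exact: (chart_contV ch hUx).
  by rewrite (chartK ch Ux); have [] := hp x Wx.
move=> f _ [x [Wx Ux] <-] /=; rewrite (sK _ Wx).
apply: iff_trans (chart_hol_near sM ch (f \o p) Ux).
split=> [|fp]; first by have [_ H] := hp x Wx; exact: H.
have := (hs x Wx).2 (f \o p); rewrite (sK _ Wx) => /(_ fp); apply: eQ.
have opW : open (p @` W) by apply: op.
have pWx : (p @` W) (p x) by exists x.
by apply: filterS (open_near opW pWx) => _ [y Wy <-] /=; rewrite sK.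
Qed.

Section Sub.
Variables (M : hol_space R) (A : set M).
Local Notation S := (sub_space A).

Lemma sub_val_continuous : continuous (val : S -> M).
Proof. exact: (@initial_continuous _ _ (set_val : set_type A -> M)). Qed.

Lemma sub_openP (W : set S) : open W <-> exists2 P : set M,
    open P & W = val @^-1` P.
Proof.
split; first by move=> [P oP <-]; exists P.
by move=> [P oP ->]; exists P.
Qed.

Lemma sub_continuous_at (T : topologicalType) (f : T -> S) (x : T) :
  continuous_at x (val \o f) -> continuous_at x f.
Proof.
move=> cf V /=; rewrite nbhsE => -[W [/sub_openP[P oP WP] Wfx] WV].
rewrite WP in Wfx.
have H : \forall y \near x, P (val (f y)) by apply: cf; exact: open_near.
by apply: filterS H => y Py; apply: WV; rewrite WP.
Qed.

Hypothesis sM : sheaf M.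

Lemma sub_hol_near (f : S -> C) (w : S) :
  hol_near f w <-> exists2 u : M -> C, hol_near u (val w) &
    \forall v \near w, f v = u (val v).
Proof.
split=> [[W [oW Ww /(_ w Ww)[ O [u [oO Ow hO fu]]]]]|[u [ O [oO Ow hO]] fu]].
  exists u; first by exists O.
  have H : \forall v \near w, O (val v).
    by apply: sub_val_continuous; exact: open_near.
  by apply: filterS2 (open_near oW Ww) H => v Wv Ov; exact: fu.
have /near_open[W [oW Ww WN]] := fu.
exists (W `&` val @^-1` O); split.
- by apply: openI => //; apply/sub_openP; exists O.
- by [].
- by move=> v [Wv Ov]; exists O, u; split => // z Oz [/WN].
Qed.

Lemma hol_map_at_val (w : S) : hol_map_at (val : S -> M) w.
Proof.
split; first exact: sub_val_continuous.
move=> u hu; apply/sub_hol_near; exists u => //.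
by near=> v.
Unshelve. all: by end_near. Qed.

Lemma hol_map_at_sub (N : hol_space R) (f : N -> S) x : analytic_space N ->
  hol_map_at (val \o f : N -> M) x -> hol_map_at f x.
Proof.
move=> [_ eN _] [cf hf]; have cf' := sub_continuous_at cf; split=> // u.
move=> /sub_hol_near[u' hu' uu']; have := hf u' hu'; apply: eN.
have H : \forall y \near x, u (f y) = u' (val (f y)) := cf' _ uu'.
by apply: filterS H => y /= ->.
Qed.

Lemma sub_sheaf : sheaf S.
Proof.
move=> F f oF; split=> [hF V FV w Vw|hF w [V FV Vw]].
  have [| O [u [oO Ow hO fu]]] := hF w; first by exists V.
  by exists O, u; split=> // v Ov Vv; apply: fu => //; exists V.
have [ O [u [oO Ow hO fu]]] := hF V FV w Vw.
have [P oP VP] := (sub_openP V).1 (oF V FV).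
rewrite VP in Vw.
exists (O `&` P), u; split.
- exact: openI.
- by [].
- by apply: (sheaf_sub sM oO (openI oO oP) _ hO) => y [].
- by move=> v [Ov Pv] _; apply: fu => //; rewrite VP.
Qed.

Lemma sub_ext (f g : S -> C) (w : S) :
  (\forall z \near w, f z = g z) -> hol_near f w -> hol_near g w.
Proof.
move=> fg /sub_hol_near[u hu fu]; apply/sub_hol_near; exists u => //.
by apply: filterS2 fg fu => v -> ->.
Qed.

End Sub.

(** Each coordinate of f extends to a germ on M; substituting the extensions
    into u extends u o f. *)
Lemma sub_analytic (M : hol_space R) (A : set M) :
  analytic_space M -> analytic_space (sub_space A).
Proof.
move=> aM; have sM := analytic_sheaf aM; case: aM => _ eM cM; split.
- exact: sub_sheaf.
- by move=> f g w; exact: sub_ext.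
move=> n f u w fw uw.
have /choice[F FP] : forall j, exists F : M -> C, hol_near F (val w) /\
    \forall v \near w, f v 0 j = F (val v).
  by move=> j; have /sub_hol_near[F ? ?] := fw j; exists F.
pose G y : 'rV[C]_n := \row_j F j y.
have H : \forall v \near w, f v = G (val v).
  have : \forall v \near w, forall j, f v 0 j = F j (val v).
    by apply: near_forall => j; have [] := FP j.
  by apply: filterS => v fv; apply/rowP => j; rewrite mxE fv.
apply/sub_hol_near; exists (fun y => u (G y) 0 0).
  apply: cM; last by rewrite -(nbhs_singleton H).
  move=> j; have -> : (fun y => G y 0 j) = F j by apply/funext => y; rewrite mxE.
  by have [] := FP j.
by apply: filterS H => v ->.
Qed.

End Constructions.

(** * Products *)

Lemma continuous_pair_at (T U V : topologicalType) (f : T -> U) (g : T -> V) x :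
  continuous_at x f -> continuous_at x g -> continuous_at x (fun y => (f y, g y)).
Proof. exact: cvg_pair. Qed.

Lemma fst_continuous_at (T U : topologicalType) (z : T * U) :
  continuous_at z (fst : T * U -> T).
Proof. exact: cvg_fst. Qed.

Lemma snd_continuous_at (T U : topologicalType) (z : T * U) :
  continuous_at z (snd : T * U -> U).
Proof. exact: cvg_snd. Qed.

Lemma hausdorffP (T : topologicalType) : hausdorff_space T <->
  forall x y : T, x <> y -> exists U V, [/\ open U, open V, U x, V y &
    forall z, U z -> V z -> False].
Proof.
rewrite open_hausdorff; split=> H x y xy.
  have [|[U V] /= [/set_mem Ux /set_mem Vy] [oU oV /eqP UV0]] := H x y.
    exact/eqP.
  exists U, V; split => // z Uz Vz.
  have : (U `&` V) z by [].
  by rewrite UV0.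
have [|U [V [oU oV Ux Vy UV]]] := H x y; first exact/eqP.
exists (U, V); first by split; exact/mem_set.
split => //; apply/eqP/seteqP; split=> // z [Uz Vz]; exact: UV Uz Vz.
Qed.

Lemma hausdorff_sep (T U : topologicalType) (f : T -> U) (x y : T) :
  hausdorff_space U -> continuous f -> f x <> f y ->
  exists V W, [/\ open V, open W, V x, W y & forall z, V z -> W z -> False].
Proof.
move=> /hausdorffP hU /continuousP cf fxy.
have [V [W [oV oW Vx Wy VW]]] := hU _ _ fxy.
by exists (f @^-1` V), (f @^-1` W); split=> //; [exact: cf|exact: cf|move=> z;
  exact: VW].
Qed.

Lemma hausdorff_inj (T U : topologicalType) (f : T -> U) :
  hausdorff_space U -> continuous f -> injective f -> hausdorff_space T.
Proof.
move=> hU cf fi; apply/hausdorffP => x y xy.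
by apply: hausdorff_sep cf _ => // /fi.
Qed.

Lemma prod_hausdorff (T U : topologicalType) :
  hausdorff_space T -> hausdorff_space U -> hausdorff_space (T * U)%type.
Proof.
move=> hT hU; apply/hausdorffP => -[x x'] [y y'] xy.
have [exy|nxy] := pselect (x = y).
  apply: (@hausdorff_sep _ _ snd) => //; first by move=> z; exact: cvg_snd.
  by move=> /= xy'; apply: xy; rewrite exy xy'.
by apply: (@hausdorff_sep _ _ fst) => // z; exact: cvg_fst.
Qed.

Lemma second_countableP (T : topologicalType) : @second_countable T <->
  exists B : set (set T), [/\ countable B, B `<=` open &
    forall (x : T) O, open O -> O x -> exists V, [/\ B V, V x & V `<=` O]].
Proof.
split=> [[B cB [Bo Bx]]|[B [cB Bo Bx]]].
  exists B; split=> // x O oO Ox.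
  by have [V [BV Vx] VO] := Bx x O (open_near oO Ox); exists V.
exists B => //; split=> // x N; rewrite nbhsE => -[ O [oO Ox] ON].
have [V [BV Vx VO]] := Bx x O oO Ox.
by exists V => //; exact: subset_trans VO ON.
Qed.

Lemma countable_image (T U : Type) (f : T -> U) (A : set T) :
  countable A -> countable (f @` A).
Proof. exact/card_le_trans/card_image_le. Qed.

Lemma setX_open (T U : topologicalType) (A : set T) (B : set U) :
  open A -> open B -> open (A `*` B).
Proof.
move=> oA oB; apply: open_pointwise => -[x y] [/= Ax By].
by exists (A, B) => //=; split; [exact: open_near oA Ax|exact: open_near oB By].
Qed.

Lemma prod_second_countable (T U : topologicalType) :
  @second_countable T -> @second_countable U -> @second_countable (T * U)%type.
Proof.
move=> /second_countableP[B [cB Bo Bx]] /second_countableP[B' [cB' Bo' Bx']].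
apply/second_countableP.
exists ((fun VW : set T * set U => VW.1 `*` VW.2) @` (B `*` B')); split.
- apply: countable_image; exact: countableX.
- by move=> _ [[V W] /= [BV BW] <-]; apply: setX_open; [exact: Bo|exact: Bo'].
- move=> [x y] O oO Oxy.
  have [[P Q] /= [Px Qy] PQ] := open_near oO Oxy.
  have /near_open[P' [oP' Px' PP']] := Px.
  have /near_open[Q' [oQ' Qx' QQ']] := Qy.
  have [V [BV Vx VP]] := Bx x P' oP' Px'.
  have [W [BW Wx WQ]] := Bx' y Q' oQ' Qx'.
  exists (V `*` W); split=> //; first by exists (V, W).
  move=> [a b] [/= Va Wb]; apply: PQ; split; [exact/PP'/VP|exact/QQ'/WQ].
Qed.

Lemma image_second_countable (T U : topologicalType) (f : T -> U) :
  continuous f -> (forall O, open O -> open (f @` O)) ->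
    (forall y, exists x, f x = y) ->
  @second_countable T -> @second_countable U.
Proof.
move=> /continuousP cf fo fs /second_countableP[B [cB Bo Bx]].
apply/second_countableP; exists ((fun V => f @` V) @` B); split.
- exact: countable_image.
- by move=> _ [V BV <-]; apply: fo; exact: Bo.
- move=> y O oO Oy; have [x xy] := fs y.
  have [|V [BV Vx VO]] := Bx x (f @^-1` O) (cf _ oO); first by rewrite /= xy.
  exists (f @` V); split; [by exists V|by exists x|].
  by move=> _ [z /VO Vz <-].
Qed.

Lemma sub_second_countable (R : realType) (M : hol_space R) (A : set M) :
  @second_countable M -> @second_countable (sub_space A).
Proof.
move=> /second_countableP[B [cB Bo Bx]]; apply/second_countableP.
exists ((fun V => val @^-1` V) @` B); split.
- exact: countable_image.
- by move=> _ [V BV <-]; apply/sub_openP; exists V => //; exact: Bo.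
- move=> w O /sub_openP[P oP ->] Pw.
  have [V [BV Vx VO]] := Bx (val w) P oP Pw.
  by exists (val @^-1` V); split=> //; [exists V|move=> v /VO].
Qed.

Section Products.
Context {R : realType}.
Local Notation C := (Cx R).
Variables (M N : hol_space R) (mM : complex_manifold M) (mN : complex_manifold N).
Local Notation P := (prod_space M N).

Lemma prod_sheaf : sheaf P.
Proof.
move=> F f _; split=> [hF V FV|hF] m n U h k U' h' k' ch ch' v.
  move=> [z [Vz Uz] <-]; apply: (hF _ _ _ _ _ _ _ _ ch ch').
  by exists z => //; split=> //; exists V.
move=> [z [[V FV Vz] Uz] <-]; apply: (hF V FV _ _ _ _ _ _ _ _ ch ch').
by exists z.
Qed.

Lemma chart_coord_hol (Q : hol_space R) n (U : set Q) (h : Q ->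
    'rV[C]_n) k (x : Q) j :
  sheaf Q -> is_chart U h k -> U x -> hol_near (fun y => h y 0 j) x.
Proof.
move=> sQ ch Ux; apply/(chart_hol_near sQ ch _ Ux).
have hUx : (h @` U) (h x) by exists x.
have H : C1_near (h \o k) (h x).
  apply: C1_near_eq (C1_near_id (h x)).
  apply: filterS (open_near (chart_openI ch) hUx) => v hv.
  by have [] := chart_invK ch hv.
by apply: filterS H => v /(_ j).
Qed.

(** The coordinates of h are holomorphic functions, so they are C^1 in any
    other chart. *)
Lemma chart_transition (Q : hol_space R) n (U : set Q) (h : Q -> 'rV[C]_n) k
    n' (U' : set Q) (h' : Q -> 'rV[C]_n') k' (x : Q) :
  sheaf Q -> is_chart U h k -> is_chart U' h' k' -> U x -> U' x ->
  C1_near (h \o k') (h' x).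
Proof.
move=> sQ ch ch' Ux Ux'; apply: near_forall => j.
have := chart_coord_hol j sQ ch Ux.
by move=> /(chart_hol_near sQ ch' _ Ux').
Qed.

Section ProdChart.
Variables (m n : nat) (U : set M) (h : M -> 'rV[C]_m) (k : 'rV[C]_m -> M).
Variables (U' : set N) (h' : N -> 'rV[C]_n) (k' : 'rV[C]_n -> N).
Hypotheses (ch : is_chart U h k) (ch' : is_chart U' h' k').

Let H (z : P) := row_mx (h z.1) (h' z.2).
Let I (v : 'rV[C]_(m + n)) : P := (k (lsubmx v), k' (rsubmx v)).

Lemma prod_chartK z : (U `*` U') z -> I (H z) = z.
Proof.
case: z => x y [/= Ux Uy].
by rewrite /I /H row_mxKl row_mxKr (chartK ch Ux) (chartK ch' Uy).
Qed.

Lemma prod_chart_cont z : (U `*` U') z -> continuous_at z H.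
Proof.
move=> [Ux Uy]; apply: continuous_row_mx.
  by apply: (@continuous_comp P M _ fst h z);
    [exact: fst_continuous_at|exact: chart_cont ch _ Ux].
by apply: (@continuous_comp P N _ snd h' z);
  [exact: snd_continuous_at|exact: chart_cont ch' _ Uy].
Qed.

Lemma prod_chart_contV z : (U `*` U') z -> continuous_at (H z) I.
Proof.
move=> [Ux Uy]; apply: continuous_pair_at.
  apply: continuous_comp; first exact: C1_near_continuous (C1_near_lsubmx _).
  by rewrite row_mxKl; apply: (chart_contV ch); exists z.1.
apply: continuous_comp; first exact: C1_near_continuous (C1_near_rsubmx _).
by rewrite row_mxKr; apply: (chart_contV ch'); exists z.2.
Qed.

Lemma prod_chart_near z : (U `*` U') z ->
  \forall v \near H z, [/\ H (I v) = v & (U `*` U') (I v)].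
Proof.
move=> [Ux Uy].
have oUz : (h @` U) (lsubmx (H z)) by rewrite row_mxKl; exists z.1.
have oUz' : (h' @` U') (rsubmx (H z)) by rewrite row_mxKr; exists z.2.
have c1 := C1_near_continuous (C1_near_lsubmx (H z)).
have c2 := C1_near_continuous (C1_near_rsubmx (H z)).
have H1 : \forall v \near H z, (h @` U) (lsubmx v).
  exact: (c1 _ (open_near (chart_openI ch) oUz)).
have H2 : \forall v \near H z, (h' @` U') (rsubmx v).
  exact: (c2 _ (open_near (chart_openI ch') oUz')).
apply: filterS2 H1 H2 => v /(chart_invK ch)[e1 U1] /(chart_invK ch')[e2 U2].
by rewrite /H /I /= e1 e2 hsubmxK.
Qed.

(** The structure of a product is defined by all pairs of charts; one pair
    suffices, since two pairs differ by transition maps, which are C^1. *)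
Lemma prod_hol_near (f : P -> C) (z : P) : (U `*` U') z ->
  hol_near f z <-> \forall v \near H z, C1_at (f \o I) v.
Proof.
move=> Uz; split.
  move=> [W [oW Wz hW]].
  have h0 := hW _ _ _ _ _ _ _ _ ch ch'.
  have WI : \forall v \near H z, W (I v).
    have := prod_chart_contV Uz; rewrite /continuous_at prod_chartK// => c.
    exact: (c _ (open_near oW Wz)).
  apply: filterS2 WI (prod_chart_near Uz) => v Wv [HIv UIv].
  by apply: h0; exists (I v).
move=> /near_open[D [oD DHz DC]].
have oUU : open (U `*` U') := setX_open (chart_open ch) (chart_open ch').
have HD : \forall w \near z, D (H w) := prod_chart_cont Uz (open_near oD DHz).
have /near_open[W [oW Wz WUD]] := near_and (open_near oUU Uz) HD.
exists W; split; [exact: oW|exact: Wz|].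
move=> m1 n1 U1 h1 k1 U1' h1' k1' ch1 ch1' _ [w [Ww [U1w U1w']] <-].
have [Uw Dw] := WUD w Ww.
have fI : C1_near (fun v => (f (I v))%:M : 'rV_1) (H w).
  by apply/C1_near_scalar/near_open; exists D.
pose H1 (z : P) := row_mx (h1 z.1) (h1' z.2).
pose I1 (v : 'rV[C]_(m1 + n1)) : P := (k1 (lsubmx v), k1' (rsubmx v)).
have sM := manifold_sheaf mM. have sN := manifold_sheaf mN.
have tr : C1_near (H \o I1) (H1 w).
  apply: C1_near_row_mx.
    apply: (@C1_near_comp _ _ _ _ _ (h \o k1)); first exact: C1_near_lsubmx.
    by rewrite row_mxKl; apply: chart_transition ch1 _ _;
      [exact: sM|exact: ch|exact: Uw.1|].
  apply: (@C1_near_comp _ _ _ _ _ (h' \o k1')); first exact: C1_near_rsubmx.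
  by rewrite row_mxKr; apply: chart_transition ch1' _ _;
    [exact: sN|exact: ch'|exact: Uw.2|].
have I1w : I1 (H1 w) = w.
  by rewrite /I1 /H1 row_mxKl row_mxKr (chartK ch1 U1w) (chartK ch1' U1w');
    case: (w).
have cI1 : continuous_at (H1 w) I1.
  apply: continuous_pair_at.
    apply: continuous_comp; first exact: C1_near_continuous (C1_near_lsubmx _).
    by rewrite row_mxKl; apply: (chart_contV ch1); exists w.1.
  apply: continuous_comp; first exact: C1_near_continuous (C1_near_rsubmx _).
  by rewrite row_mxKr; apply: (chart_contV ch1'); exists w.2.
have fII : C1_near (fun v => (f (I (H (I1 v))))%:M : 'rV_1) (H1 w).
  by apply: (@C1_near_comp _ _ _ _ (H \o I1) (fun v => (f (I v))%:M));
    rewrite /= ?I1w.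
have UI1 : \forall v \near H1 w, (U `*` U') (I1 v).
  by move: cI1; rewrite /continuous_at I1w => c; exact: (c _ (open_near oUU Uw)).
suff : C1_near (fun v => (f (I1 v))%:M : 'rV_1) (H1 w).
  by move=> /C1_near_scalar/nbhs_singleton.
apply: C1_near_eq fII.
by apply: filterS UI1 => v UIv; rewrite prod_chartK.
Qed.

Lemma prod_chart : is_chart (U `*` U' : set P) H I.
Proof.
have oUU : open (U `*` U') := setX_open (chart_open ch) (chart_open ch').
apply: is_chart_intro.
- exact: prod_sheaf.
- exact: oUU.
- apply: open_pointwise => _ [z Uz <-].
  by apply: filterS (prod_chart_near Uz) => v [Hv Uv]; exists (I v).
- exact: prod_chartK.
- exact: prod_chart_cont.
- by move=> _ [z Uz <-]; exact: prod_chart_contV.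
- exact: prod_hol_near.
Qed.

End ProdChart.

Lemma prod_manifold : complex_manifold P.
Proof.
case: (mM) => hM cM _ chM; case: (mN) => hN cN _ chN; split.
- exact: prod_hausdorff.
- exact: prod_second_countable.
- exact: prod_sheaf.
move=> [x y]; have [m [U [h [k [ch Ux]]]]] := chM x.
have [n [U' [h' [k' [ch' Uy]]]]] := chN y.
exists (m + n)%N, (U `*` U'), (fun z => row_mx (h z.1) (h' z.2)),
  (fun v => (k (lsubmx v), k' (rsubmx v))).
by split; first exact: prod_chart.
Qed.

Lemma hol_map_at_fst (z : P) : hol_map_at (fst : P -> M) z.
Proof.
split; first exact: fst_continuous_at.
case: (mM) => _ _ _ /(_ z.1)[m [U [h [k [ch Ux]]]]].
case: (mN) => _ _ _ /(_ z.2)[n [U' [h' [k' [ch' Uy]]]]].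
move=> u /(chart_hol_near (manifold_sheaf mM) ch _ Ux)/C1_near_scalar hu.
have Uz : (U `*` U') z by [].
apply/(prod_hol_near ch ch' _ Uz)/C1_near_scalar.
apply: (@C1_near_comp _ _ _ _ (@lsubmx _ 1 m n) (fun v => (u (k v))%:M)).
  exact: C1_near_lsubmx.
by rewrite row_mxKl.
Qed.

Lemma hol_map_at_snd (z : P) : hol_map_at (snd : P -> N) z.
Proof.
split; first exact: snd_continuous_at.
case: (mM) => _ _ _ /(_ z.1)[m [U [h [k [ch Ux]]]]].
case: (mN) => _ _ _ /(_ z.2)[n [U' [h' [k' [ch' Uy]]]]].
move=> u /(chart_hol_near (manifold_sheaf mN) ch' _ Uy)/C1_near_scalar hu.
have Uz : (U `*` U') z by [].
apply/(prod_hol_near ch ch' _ Uz)/C1_near_scalar.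
apply: (@C1_near_comp _ _ _ _ (@rsubmx _ 1 m n) (fun v => (u (k' v))%:M)).
  exact: C1_near_rsubmx.
by rewrite row_mxKr.
Qed.

(** Read in a product chart, a function of (f, g) is a C^1 function
    substituted with the coordinates of f and g; hence the domain need only be
    an analytic space. *)
Lemma hol_map_at_pair (Q : hol_space R) (f : Q -> M) (g : Q -> N) (x : Q) :
  analytic_space Q -> hol_map_at f x -> hol_map_at g x ->
  hol_map_at (fun y => (f y, g y) : P) x.
Proof.
move=> [_ eQ cQ] [cf hf] [cg hg].
have cfg : continuous_at x (fun y => (f y, g y) : P) by exact: continuous_pair_at.
split; first exact: cfg.
case: (mM) => _ _ _ /(_ (f x))[m [U [h [k [ch Ux]]]]].
case: (mN) => _ _ _ /(_ (g x))[n [U' [h' [k' [ch' Uy]]]]].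
have Uz : (U `*` U') (f x, g x) by [].
move=> u /(prod_hol_near ch ch' _ Uz)/C1_near_scalar hu.
pose r y := row_mx (h (f y)) (h' (g y)).
have hr j : hol_near (fun y => r y 0 j) x.
  rewrite /r; case: (fintype.splitP j) => i ji.
    have -> : (fun y => row_mx (h (f y)) (h' (g y)) 0 j) = (fun y => h y 0 i) \o f.
      by apply/funext => y; rewrite (_ : j = lshift n i) ?row_mxEl//; exact/val_inj.
    by apply: hf; apply: chart_coord_hol ch Ux; exact: manifold_sheaf.
  have -> : (fun y => row_mx (h (f y)) (h' (g y)) 0 j) = (fun y => h' y 0 i) \o g.
    by apply/funext => y; rewrite (_ : j = rshift m i) ?row_mxEr//; exact/val_inj.
  by apply: hg; apply: chart_coord_hol ch' Uy; exact: manifold_sheaf.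
have := cQ _ r _ x hr hu; apply: eQ.
have oUU : open (U `*` U') := chart_open (prod_chart ch ch').
have H : \forall y \near x, (U `*` U') (f y, g y) := cfg _ (open_near oUU Uz).
apply: filterS H => y Uy'.
have /= e := prod_chartK ch ch' Uy'.
by rewrite mxE mulr1n /= e.
Qed.

End Products.

(** * Local compactness and connectedness of complex coordinate spaces *)

Section ComplexPlane.
Context {R : realType}.
Local Notation C := (Cx R).

Definition toC (t : R) : C := (t%:C)%C.

Lemma toC_norm (t : R) : `|toC t| = toC `|t|.
Proof. by rewrite /toC [LHS](@normc_def R) /= expr0n /= addr0 sqrtr_sqr. Qed.

Lemma toC_sub (s t : R) : toC (s - t) = toC s - toC t.
Proof. by rewrite /toC (rmorphB (real_complex R)). Qed.

Lemma gt0_toC (e : C) : 0 < e -> exists2 r : R, 0 < r & e = toC r.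
Proof.
move=> e0; exists (complex.Re e).
  by move: e0; rewrite (@ltcE R) => /andP[].
by rewrite /toC (RRe_real (gtr0_real e0)).
Qed.

Lemma toC_le (s t : R) : (toC s <= toC t) = (s <= t).
Proof. exact: lecR. Qed.

Lemma toC_lt (s t : R) : (toC s < toC t) = (s < t).
Proof. exact: ltcR. Qed.

Lemma toC_continuous : continuous toC.
Proof.
move=> x; apply/cvgrPdist_lt => e /gt0_toC[r r0 ->]; near=> t.
rewrite -toC_sub toC_norm toC_lt; near: t.
exact: cvgr_dist_lt.
Unshelve. all: by end_near. Qed.

Definition plane (z : R * R) : C := toC z.1 + ('i%C : C) * toC z.2.

Lemma plane_continuous : continuous plane.
Proof.
move=> z; apply: cvgD.
  by apply: (@continuous_comp _ _ _ fst toC z);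
    [exact: cvg_fst|exact: toC_continuous].
apply: cvgM; first exact: cvg_cst.
by apply: (@continuous_comp _ _ _ snd toC z);
  [exact: cvg_snd|exact: toC_continuous].
Qed.

Lemma normi : `|'i%C : C| = 1.
Proof. by rewrite [LHS](@normc_def R) /= expr0n /= add0r expr1n sqrtr1. Qed.

Lemma plane_norm z : `|plane z| <= toC (`|z.1| + `|z.2|).
Proof.
rewrite /plane; apply: le_trans (ler_normD _ _) _.
rewrite normrM normi mul1r !toC_norm.
by rewrite [leRHS](rmorphD (real_complex R)).
Qed.

Lemma plane_inv (w : C) : exists z : R * R,
  [/\ plane z = w, toC `|z.1| <= `|w| & toC `|z.2| <= `|w|].
Proof.
exists (complex.Re w, complex.Im w); split.
- by rewrite /plane /toC -complexE.
- exact: (@normc_ge_Re R).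
- have := @normc_ge_Re R (w * 'i%C).
  by rewrite ReiNIm normrN [X in _ <= X]normrM normi mulr1.
Qed.

(** The neighbourhood is a product of squares in the complex plane, each the
    image of a product of two real segments. *)
Lemma locally_compact_rV n (c : 'rV[C]_n) (N : set 'rV[C]_n) : nbhs c N ->
  exists K V, [/\ compact K, open V, V c, V `<=` K & K `<=` N].
Proof.
move=> /nbhs_ballP[e /= /gt0_toC[r r0 ->] cN].
pose d := r / 3; have d0 : 0 < d by rewrite divr_gt0.
pose S : set (R * R) := `[-d, d]%classic `*` `[-d, d]%classic.
pose A i : set C := (fun z => c 0 i + plane z) @` S.
have cA i : compact (A i).
  apply: continuous_compact.
    apply: continuous_subspaceT => z.
    by apply: cvgD; [exact: cvg_cst|exact: plane_continuous].
  by apply: compact_setX; exact: segment_compact.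
exists [set v : 'rV[C]_n | forall i, A i (v 0 i)], (ball c (toC d)); split.
- exact: rV_compact.
- exact: ball_open.
- by apply: ballxx; rewrite (toC_lt 0).
- move=> v [_ cv] i; have := cv 0 i; rewrite /ball /=.
  have [z [zv z1 z2]] := plane_inv (v 0 i - c 0 i) => cvi.
  have vd : `|v 0 i - c 0 i| <= toC d by rewrite distrC ltW.
  exists z; last by rewrite zv addrC subrK.
  by split; rewrite /= in_itv /= -ler_norml -toC_le;
    [exact: le_trans z1 vd|exact: le_trans z2 vd].
- move=> v Av; apply: cN; split; first by rewrite (toC_lt 0).
  move=> i j; rewrite !ord1; have [z [z1 z2] <-] := Av j.
  rewrite /ball /= opprD addrA subrr add0r normrN.
  apply: le_lt_trans (plane_norm _) _; rewrite toC_lt.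
  move: z1 z2; rewrite /= !in_itv /= -!ler_norml => z1 z2.
  apply: (@le_lt_trans _ _ (d + d)); first exact: lerD.
  by rewrite /d; lra.
Qed.

Lemma locally_connected_rV n (c : 'rV[C]_n) (N : set 'rV[C]_n) : nbhs c N ->
  exists W, [/\ connected W, open W, W c & W `<=` N].
Proof.
move=> /nbhs_ballP[e /= e0 cN].
exists (ball c e); split; [|exact: ball_open|exact: ballxx|exact: cN].
pose seg v (t : R) : 'rV[C]_n := c + toC t *: (v - c).
have segc v : connected (seg v @` `[0, 1]).
  apply: connected_continuous_connected; first exact: segment_connected.
  apply: continuous_subspaceT => t.
  apply: cvgD; first exact: cvg_cst.
  by apply: cvgZr_tmp; exact: toC_continuous.
have -> : ball c e = \bigcup_(v in ball c e) (seg v @` `[0, 1]).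
  apply/seteqP; split=> [v cv|_ [v cv [t /= t01 <-]]].
    exists v => //; exists 1; first by rewrite /= in_itv /= ler01 lexx.
    by rewrite /seg scale1r addrC subrK.
  move: cv; rewrite -ball_normE /= => cv.
  rewrite /seg opprD addrA subrr add0r normrN normrZ toC_norm.
  move: t01; rewrite in_itv /= => /andP[t0 t1].
  apply: le_lt_trans cv; rewrite distrC ler_piMl//.
  by rewrite ger0_norm// (toC_le _ 1).
apply: bigcup_connected; last by move=> v _; exact: segc.
exists c => v cv; exists 0; first by rewrite /= in_itv /= lexx ler01.
by rewrite /seg scale0r addr0.
Qed.

End ComplexPlane.

(** * Inverses of holomorphic families of biholomorphic maps *)

Definition locally_compact (T : topologicalType) := forall (x : T) N, nbhs x N ->
  exists K V, [/\ compact K, open V, V x, V `<=` K & K `<=` N].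

Definition locally_connected (T : topologicalType) := forall (x : T) N, nbhs x N ->
  exists W, [/\ connected W, open W, W x & W `<=` N].

Section TopFamily.
Variables (Y G : topologicalType) (F : Y * G -> G) (inv : Y -> G -> G).
Hypotheses (hG : hausdorff_space G) (lc : locally_compact G)
  (lcn : locally_connected G).
Hypotheses (cF : continuous F) (cinv : forall y, continuous (inv y)).
Hypotheses (FK : forall y g, inv y (F (y, g)) = g) (invK : forall y g, F (y,
  inv y g) = g).

(** Let g0 = inv y0 w0, and let K be a compact neighbourhood of g0 and V an
    open part of K containing g0.  No F(y0,
      x) with x in the boundary layer K \ V equals w0;
    by compactness this persists for (y, w) near (y0, w0).  If W is a small
    connected neighbourhood of w0, its image under inv y is connected, avoids
    K \ V, and contains g0 because F(y, g0) lies in W; so it lies in V. *)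
Lemma family_inv_continuous : continuous (fun z : Y * G => inv z.1 z.2).
Proof.
move=> [y0 w0] N0 /=; set g0 := inv y0 w0 => nN0.
have [K [V [cK oV Vg VK KN]]] := lc nN0.
have cS : compact (K `\` V).
  by apply: compact_closedI => //; exact: open_closedC.
have sep x : (K `\` V) x -> \forall x' \near x & i \near (y0, w0), F (i.1,
  x') <> i.2.
  move=> [Kx nVx].
  have ne : F (y0, x) <> w0 by move=> e; apply: nVx; rewrite -(FK y0 x) e.
  have [A [B [oA oB Ax Bw AB]]] := (hausdorffP G).1 hG _ _ ne.
  have [[P Q] /= [Py Qx] PQ] := cF (open_near oA Ax).
  exists (Q, P `*` B) => /=.
    by split => //; exists (P, B) => //=; split=> //; exact: open_near.
  move=> [x' [y w]] [/= Qx' [/= Py' Bw']] e.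
  by apply: (AB w) => //; rewrite -e; exact: (PQ (y, x')).
have [ncov _] := compact_near_coveringP (K `\` V).
have H := ncov cS _ (nbhs (y0, w0)) (fun i x' => F (i.1, x') <> i.2) _ sep.
have [[P Q] /= [Py Qw] PQ] := H.
have [W [cW oW Ww WQ]] := lcn Qw.
have Py' : \forall y \near y0, W (F (y, g0)).
  have c : continuous_at y0 (fun y => F (y, g0)).
    apply: (@continuous_comp _ _ _ (fun y => (y, g0)) F); last exact: cF.
    by apply: continuous_pair_at; [exact: continuous_at_id|exact: cst_continuous].
  by apply: c; rewrite invK; exact: open_near.
exists ([set y | P y /\ W (F (y, g0))], W).
  by split=> /=; [exact: near_and|exact: open_near].
move=> [y w] [/= [Py1 Wy] Ww1]; apply/KN/VK.
have cI : connected (inv y @` W).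
  apply: connected_continuous_connected => //.
  by apply: continuous_subspaceT; exact: cinv.
have clK : closed K by exact: compact_closed.
have sV : separated V (~` K).
  split; apply/seteqP; split=> // z.
    by move=> [cVz nKz]; apply: nKz; move: cVz; rewrite closureE => /(_ K); apply.
  move=> [Vz cKz].
  have := cKz V (open_near oV Vz) => -[z' [nK Vz']].
  by apply: nK; exact: VK.
have [] := @connected_subset _ V (~` K) (inv y @` W) sV _ cI.
- move=> _ [w' Ww' <-]; have [Kz|] := pselect (K (inv y w')); last by right.
  left; apply: contrapT => nV.
  by apply: (PQ (y, w')) (conj Kz nV) _; [split=> //; exact: WQ|rewrite /= invK].
- by apply; exists w.
- move=> /(_ g0)/(_ _)/wrap[|/(_ (VK _ Vg))//].
  by exists (F (y, g0)).
Qed.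

End TopFamily.

Section ManifoldLocal.
Context {R : realType}.
Local Notation C := (Cx R).

Lemma chart_nbhs (M : hol_space R) n (U : set M) (h : M ->
    'rV[C]_n) k x (N : set M) :
  is_chart U h k -> U x -> nbhs x N ->
  \forall v \near h x, (h @` U) v /\ N (k v).
Proof.
move=> ch Ux nN; have hUx : (h @` U) (h x) by exists x.
apply: near_and; first exact: open_near (chart_openI ch) hUx.
by have := chart_contV ch hUx; rewrite /continuous_at (chartK ch Ux); apply.
Qed.

Lemma chart_image_open (M : hol_space R) n (U : set M) (h : M ->
    'rV[C]_n) k (D : set 'rV[C]_n) :
  is_chart U h k -> open D -> D `<=` h @` U -> open (k @` D).
Proof.
move=> ch oD DU; apply: open_pointwise => _ [v Dv <-].
have [hkv Ukv] := chart_invK ch (DU v Dv).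
have c := chart_cont ch Ukv; rewrite /continuous_at hkv in c.
have H : \forall y \near k v, D (h y) := c _ (open_near oD Dv).
apply: filterS2 (open_near (chart_open ch) Ukv) H => y Uy Dy.
by exists (h y) => //; rewrite (chartK ch Uy).
Qed.

Lemma manifold_locally_compact (M : hol_space R) :
  complex_manifold M -> locally_compact M.
Proof.
move=> [_ _ _ cM] x N nN; have [n [U [h [k [ch Ux]]]]] := cM x.
have [K [V [cK oV Vx VK KN]]] := locally_compact_rV (chart_nbhs ch Ux nN).
exists (k @` K), (k @` V); split.
- apply: continuous_compact => //;
  apply: continuous_in_subspaceT => v /set_mem/KN[hv _].
  exact: (chart_contV ch hv).
- by apply: (chart_image_open ch oV) => v /VK/KN[].
- by exists (h x) => //; rewrite (chartK ch Ux).
- exact: image_subset.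
- by move=> _ [v /KN[_ +] <-].
Qed.

Lemma manifold_locally_connected (M : hol_space R) :
  complex_manifold M -> locally_connected M.
Proof.
move=> [_ _ _ cM] x N nN; have [n [U [h [k [ch Ux]]]]] := cM x.
have [W [cW oW Wx WN]] := locally_connected_rV (chart_nbhs ch Ux nN).
exists (k @` W); split.
- apply: connected_continuous_connected => //.
  apply: continuous_in_subspaceT => v /set_mem/WN[hv _].
  exact: (chart_contV ch hv).
- by apply: (chart_image_open ch oW) => v /WN[].
- by exists (h x) => //; rewrite (chartK ch Ux).
- by move=> _ [v /WN[_ +] <-].
Qed.

End ManifoldLocal.

Section JacobianUnipotent.
Context {K : numFieldType}.

Lemma has_jac_unique n m (f : 'rV[K]_n -> 'rV[K]_m) (x : 'rV[K]_n) J J' :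
  has_jac f x J -> has_jac f x J' -> J = J'.
Proof.
move=> /has_jac_coordP jf /has_jac_coordP jf'; apply/matrixP => i j.
have [_ dJ] := jac_differentiable (jf j).
have [_ dJ'] := jac_differentiable (jf' j).
have e (A : 'M[K]_(n, m)) : ((delta_mx 0 i : 'rV[K]_n) *m col j A) 0 0 = A i j.
  by rewrite -rowE !mxE.
by rewrite -(e J) -(e J') -dJ -dJ'.
Qed.

(** A map that preserves the first block of coordinates, and is the identity
    on the slice through x, has a Jacobian J with (J - 1)^2 = 0. *)
Lemma shear_jacobian m n (f : 'rV[K]_(m + n) ->
    'rV[K]_(m + n)) (x : 'rV[K]_(m + n)) J :
  (\forall v \near x, lsubmx (f v) = lsubmx v) ->
  (\forall w \near rsubmx x, f (row_mx (lsubmx x) w) = row_mx (lsubmx x) w) ->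
  has_jac f x J -> J *m (1%:M - (J - 1%:M)) = 1%:M.
Proof.
move=> fl fr jf; set E := J - 1%:M.
pose L1 : 'M[K]_(m + n, m) := col_mx 1%:M 0.
pose R1 : 'M[K]_(m + n, n) := col_mx 0 1%:M.
pose i2 : 'M[K]_(n, m + n) := row_mx 0 1%:M.
have lE p (A : 'M[K]_(p, m + n)) : lsubmx A = A *m L1.
  by rewrite -[in RHS](hsubmxK A) mul_row_col mulmx1 mulmx0 addr0.
have jE : has_jac (fun v => f v - v) x E.
  case: jf => A [cA AJ fA]; exists (fun v => A v - 1%:M); split.
  - by apply: continuous_add; [exact: cA|exact: cst_continuous].
  - by rewrite AJ.
  - apply: filterS fA => v fv; rewrite mulmxBr mulmx1 -fv !opprB.
    by rewrite addrACA [RHS]addrACA [X in _ + X]addrC.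
have EL : E *m L1 = 0.
  apply: (@has_jac_unique _ _ (mulmx^~ L1 \o (fun v => f v - v)) x).
    by apply: has_jac_comp jE _; exact: has_jac_mulmx.
  apply: (has_jac_near _ (has_jac_cst 0 x)).
  by apply: filterS fl => v /= fv; rewrite mulmxBl -!lE fv subrr.
have iE : i2 *m E = 0.
  pose io w : 'rV[K]_(m + n) := row_mx (lsubmx x) w.
  have jio : has_jac io (rsubmx x) i2.
    exists (fun=> i2); split; [exact: cst_continuous|by []|].
    near=> w; rewrite /io opp_row_mx add_row_mx subrr /i2 mul_mx_row mulmx0
      mulmx1 //.
  apply: (@has_jac_unique _ _ ((fun v => f v - v) \o io) (rsubmx x)).
    by apply: has_jac_comp jio _; rewrite /io hsubmxK.
  apply: (has_jac_near _ (has_jac_cst 0 _)).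
  by apply: filterS fr => w /= fw; rewrite fw subrr.
have id2 : L1 *m (row_mx 1%:M 0 : 'M[K]_(m, (m + n)%N)) + R1 *m i2 = 1%:M.
  rewrite /L1 /R1 /i2 !mul_col_mx !mul_mx_row !mulmx0 !mulmx1 ?mul0mx ?mul1mx.
  by rewrite add_col_mx !add_row_mx !addr0 !add0r [RHS]scalar_mx_block.
have EE : E *m E = 0.
  rewrite -[E in E *m _]mulmx1 -id2 mulmxDr mulmxA EL mul0mx add0r.
  by rewrite -!mulmxA iE !mulmx0.
have -> : J = 1%:M + E by rewrite /E addrC subrK.
by rewrite mulmxBr mulmx1 mulmxDl mul1mx EE addr0 addrK.
Unshelve. all: by end_near. Qed.

End JacobianUnipotent.

Section HolFamily.
Context {R : realType}.
Local Notation C := (Cx R).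

(** A constant is a function of zero variables. *)
Lemma hol_map_at_cst (M N : hol_space R) (c : N) (x : M) : analytic_space M ->
  hol_map_at (fun=> c) x.
Proof.
move=> [_ eM cM]; split; first exact: cst_continuous.
move=> u _; have k1 : C1_near (fun=> (u c)%:M : 'rV[C]_1) (0 : 'rV[C]_0).
  apply/C1_nearP; exists (fun=> 0); near=> v.
  by split; [exact: cst_continuous|exact: has_jac_cst].
have := cM 0%N (fun=> 0) _ x _ k1 => /(_ _)/wrap[|]; first by case.
by apply: eM; near=> y; rewrite mxE mulr1n.
Unshelve. all: by end_near. Qed.
Variables (Y G : hol_space R) (mY : complex_manifold Y) (mG : complex_manifold G).
Local Notation P := (prod_space Y G).

(** The case in which F(y0, -) is the identity: source and target then have
    the same chart, and in it (y, g) |-> (y, F(y, g)) is a shear. *)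
Lemma family_inv_hol_at_id (F N : P -> G) (y0 : Y) (g0 : G) :
  hol_map_at F (y0, g0) -> continuous N ->
  (forall y g, F (y, N (y, g)) = g) -> (forall g, F (y0, g) = g) ->
  hol_map_at N (y0, g0).
Proof.
move=> hF cN FN F0; split; first exact: cN.
have sG := manifold_sheaf mG.
have N0 : N (y0, g0) = g0 by rewrite -[LHS]F0 FN.
case: (mY) => _ _ _ /(_ y0)[m [V [h' [k' [ch' Vy]]]]].
case: (mG) => _ _ _ /(_ g0)[n [U [h [k [ch Ug]]]]].
pose H (z : P) := row_mx (h' z.1) (h z.2).
pose I (v : 'rV[C]_(m + n)) : P := (k' (lsubmx v), k (rsubmx v)).
have VU : (V `*` U) (y0, g0) by [].
have pch : is_chart (V `*` U : set P) H I := prod_chart mY mG ch' ch.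
set c := H (y0, g0).
have Ic : I c = (y0, g0) := prod_chartK ch' ch VU.
have HVU : (H @` (V `*` U)) c by exists (y0, g0).
have cI : continuous_at c I := chart_contV pch HVU.
pose T v := row_mx (lsubmx v) (h (F (I v))).
pose X v := row_mx (lsubmx v) (h (N (I v))).
have Xc : X c = c by rewrite /X Ic N0 /c /H row_mxKl.
(* The region in which both I v and N (I v) stay inside the charts. *)
have good : \forall v \near c, (H @` (V `*` U)) v /\ U (N (I v)).
  apply: near_and; first exact: open_near (chart_openI pch) HVU.
  have cNI : continuous_at c (N \o I).
    by apply: (@continuous_comp _ P _ I N c) => //; exact: cN.
  by have := cNI _ ; rewrite /= Ic N0; apply; exact: open_near (chart_open ch) Ug.
have TX : \forall v \near c, T (X v) = v.
  apply: filterS good => v [hv UN].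
  have [Hv [/= Vv Uv]] := chart_invK pch hv.
  have e : I (X v) = ((I v).1, N (I v)).
    by rewrite /I /X row_mxKl row_mxKr (chartK ch UN).
  have FN' : F ((I v).1, N (I v)) = (I v).2 by rewrite -[RHS](FN
    (I v).1) -surjective_pairing.
  rewrite /T e FN' row_mxKl -[RHS]Hv /H; congr row_mx.
  by rewrite -[in LHS]Hv row_mxKl.
have cX : \forall v \near c, continuous_at v X.
  apply: filterS good => v [hv UN].
  apply: continuous_row_mx; first exact: C1_near_continuous (C1_near_lsubmx _).
  apply: (@continuous_comp _ G _ (N \o I) h); last exact: (chart_cont ch UN).
  apply: (@continuous_comp _ P _ I N); last exact: cN.
  exact: (chart_contV pch hv).
have T1 : C1_near T c.
  apply: C1_near_row_mx; first exact: C1_near_lsubmx.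
  apply: near_forall => j.
  have hj := chart_coord_hol j sG ch Ug.
  have := hF.2 (fun g => h g 0 j); rewrite F0 => /(_ hj).
  by move=> /(prod_hol_near mY mG ch' ch _ VU).
have [J0 /nbhs_singleton[_ jT]] := (C1_nearP T c).1 T1.
have X1 : C1_near X c.
  refine (@C1_near_inv _ _ _ T X c (1%:M - (J0 c - 1%:M)) cX TX _ _).
    by rewrite Xc.
  rewrite Xc => J jJ; rewrite (has_jac_unique jJ jT).
  apply: shear_jacobian jT; first by near=> v; rewrite row_mxKl.
  have ec : lsubmx c = h' y0 by rewrite /c row_mxKl.
  have hUg : (h @` U) (h g0) by exists g0.
  rewrite ec [X in \near X, _](_ : _ = h g0) ?row_mxKr//.
  apply: filterS (open_near (chart_openI ch) hUg) => w /(chart_invK ch)[hw Uw].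
  by rewrite /T /I row_mxKl row_mxKr (chartK ch' Vy) F0 hw.
move=> u; rewrite N0 => /(chart_hol_near sG ch _ Ug)/C1_near_scalar hu.
apply/(prod_hol_near mY mG ch' ch _ VU)/C1_near_scalar.
have r1 : C1_near (fun v => (u (k (rsubmx (X v))))%:M : 'rV_1) c.
  apply: (@C1_near_comp _ _ _ _ (@rsubmx _ 1 m n \o X) (fun w => (u (k w))%:M)).
    by apply: C1_near_comp X1 _; exact: C1_near_rsubmx.
  by rewrite /= Xc /c row_mxKr.
apply: C1_near_eq r1; apply: filterS good => v [_ UN].
by rewrite /X row_mxKr (chartK ch UN).
Unshelve. all: by end_near. Qed.

(** The general case reduces to a family that is the identity at y0, by
    composing with inv y0. *)
Lemma family_inv_hol (F : P -> G) (inv : Y -> G -> G) :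
  holomorphic F -> (forall y, holomorphic (inv y)) ->
  (forall y g, inv y (F (y, g)) = g) -> (forall y g, F (y, inv y g) = g) ->
  holomorphic (fun z : P => inv z.1 z.2).
Proof.
move=> hF hinv FK invK.
have mP := prod_manifold mY mG; have sP := manifold_sheaf mP.
have aP := manifold_analytic mP; have sG := manifold_sheaf mG.
have hFa := (holomorphicP F sP).1 hF.
have hia y := (holomorphicP (inv y) sG).1 (hinv y).
have hG : hausdorff_space G by case: mG.
have cinv : continuous (fun z : P => inv z.1 z.2).
  apply: (@family_inv_continuous Y G F inv) => //.
  - exact: manifold_locally_compact.
  - exact: manifold_locally_connected.
  - by case: hF.
  - by move=> y; case: (hinv y).
apply/(holomorphicP _ sP) => -[y0 w0]; set g0 := inv y0 w0.
pose F' (z : P) := inv y0 (F z).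
pose N (z : P) := inv z.1 (F (y0, z.2)).
have pair_hol z : hol_map_at (fun z : P => (y0, z.2) : P) z.
  apply: hol_map_at_pair => //; last exact: hol_map_at_snd.
  exact: hol_map_at_cst.
have cN : continuous N.
  move=> z; apply: (@continuous_comp P P G (fun z => (z.1, F (y0,
    z.2))) (fun z => inv z.1 z.2)); last exact: cinv.
  apply: continuous_pair_at; first exact: fst_continuous_at.
  apply: (@continuous_comp P P G (fun z => (y0, z.2)) F).
    by have [] := pair_hol z.
  by case: hF => + _; apply.
have hN : hol_map_at N (y0, g0).
  apply: (@family_inv_hol_at_id F') => //.
  - by apply: (@hol_map_at_comp _ P G G F (inv y0)); [exact: hFa|exact: hia].
  - by move=> y g; rewrite /F' /N /= invK FK.
  - by move=> g; rewrite /F' FK.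
have -> : (fun z : P => inv z.1 z.2) = N \o (fun z : P => (z.1, inv y0 z.2) : P).
  by apply/funext => z; rewrite /N /= invK.
refine (@hol_map_at_comp _ P P G (fun z : P => (z.1, inv y0 z.2) : P) N (y0,
  w0) _ hN).
apply: (hol_map_at_pair mY mG aP); first exact: hol_map_at_fst.
apply: (@hol_map_at_comp _ P G G snd (inv y0)); first exact: hol_map_at_snd.
exact: hia.
Qed.

End HolFamily.

(** * Open subspaces, transport of structure, coverings *)

Section Subspaces.
Context {R : realType}.

(** Corestriction of a point to A, with the arbitrary value w off A; it turns
    maps that land in A near a point into total maps. *)
Definition to_sub (M : hol_space R) (A : set M) (w : sub_space A)
    (x : M) : sub_space A :=
  if pselect (A x) is left Ax then in_sub Ax else w.

Lemma to_subE (M : hol_space R) (A : set M) (w : sub_space A) (x : M) :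
  A x -> val (to_sub w x) = x.
Proof. by rewrite /to_sub => Ax; case: pselect. Qed.

Lemma to_subK (M : hol_space R) (A : set M) (w : sub_space A) (v : sub_space A) :
  to_sub w (val v) = v.
Proof. by apply/val_inj; rewrite to_subE//; exact: in_subP. Qed.

Lemma hol_map_at_to_sub (M N : hol_space R) (A : set M) (w : sub_space A)
    (f : N -> M) x :
  analytic_space N -> hol_map_at f x -> (\forall y \near x, A (f y)) ->
  hol_map_at (fun y => to_sub w (f y)) x.
Proof.
move=> aN hf Af; apply: hol_map_at_sub => //.
by apply: hol_map_at_eq hf => //; apply: filterS Af => y Afy; rewrite /= to_subE.
Qed.

Lemma sub_map_hol (M N : hol_space R) (A : set M) (B : set N) (f : M -> N)
    (fAB : forall z, A z -> B (f z)) :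
  analytic_space M -> (forall x, A x -> hol_map_at f x) -> 
  forall a, @hol_map_at R (sub_space A) (sub_space B) (sub_map fAB) a.
Proof.
move=> aM hf a; apply: hol_map_at_sub; first exact: sub_analytic.
apply: (@hol_map_at_comp _ (sub_space A) M N val f a); first exact: hol_map_at_val.
by apply: hf; exact: in_subP.
Qed.

Lemma open_sub_manifold (M : hol_space R) (A : set M) :
  open A -> complex_manifold M -> complex_manifold (sub_space A).
Proof.
move=> oA mM; have aM := manifold_analytic mM.
have aA := sub_analytic A aM.
case: (mM) => hM cM sM chM; split.
- apply: (hausdorff_inj hM (@sub_val_continuous _ M A)); exact: val_inj.
- exact: sub_second_countable.
- exact: analytic_sheaf.
move=> w; rewrite -[w](to_subK w).
apply: (@chart_push _ M (sub_space A) (to_sub w) val A) => //.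
- exact: analytic_sheaf.
- by case: aA.
- exact: in_subP.
- move=> O oO OA; have -> : to_sub w @` O = val @^-1` O.
    apply/seteqP; split=> [_ [x Ox <-] /=|v /= Ov].
      by rewrite to_subE//; exact: OA.
    by exists (val v) => //; rewrite to_subK.
  by apply/sub_openP; exists O.
- by move=> x Ax; rewrite to_subE.
- move=> x Ax; apply: (@hol_map_at_to_sub M M A w id) => //;
  first exact: hol_map_at_id.
  exact: open_near.
- by move=> x Ax; exact: hol_map_at_val.
Qed.

Lemma biholo_manifold (M Q : hol_space R) (f : M -> Q) (g : Q -> M) :
  (forall x, hol_map_at f x) -> (forall y, hol_map_at g y) ->
  cancel f g -> cancel g f -> complex_manifold M -> analytic_space Q ->
  complex_manifold Q.
Proof.
move=> hf hg fK gK mM aQ; case: (mM) => hM cM sM chM.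
have cf : continuous f by move=> x; have [] := hf x.
have cg : continuous g by move=> x; have [] := hg x.
have fo O : open O -> open (f @` O).
  move=> oO; have -> : f @` O = g @^-1` O.
    apply/seteqP; split=> [_ [x Ox <-] /=|y /= Oy]; first by rewrite fK.
    by exists (g y).
  by move/continuousP : cg; exact.
split.
- by apply: (hausdorff_inj hM cg); exact: can_inj gK.
- by apply: image_second_countable cM => // y; exists (g y).
- exact: analytic_sheaf.
move=> y; rewrite -(gK y).
apply: (@chart_push _ M Q f g setT) => //.
- exact: analytic_sheaf.
- by case: aQ.
- exact: openT.
- by move=> O oO _; exact: fo.
Qed.

End Subspaces.

Section LieTransport.
Context {R : realType}.

Lemma lie_group_transport (G H : grp_space R) (f : G -> H) (g : H -> G) :
  (forall x, hol_map_at f x) -> (forall y, hol_map_at g y) ->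
  cancel f g -> cancel g f -> {morph f : a b / gmul a b} ->
  complex_lie_group G -> complex_manifold H -> complex_lie_group H.
Proof.
move=> hf hg fK gK fM [mG mA hmul [e [e1 e2] [i [hi i1 i2]]]] mH.
have aG := manifold_analytic mG; have aH := manifold_analytic mH.
have mHH := prod_manifold mH mH; have aHH := manifold_analytic mHH.
have mGG := prod_manifold mG mG.
have mulE a b : gmul a b = f (gmul (g a) (g b)) by rewrite fM !gK.
split; first exact: mH.
- by move=> a b c; rewrite !mulE !fK mA.
- apply/(holomorphicP _ (analytic_sheaf aHH)) => z.
  pose mulG (z : prod_space G G) : G := gmul z.1 z.2.
  have -> : (fun z : prod_space H H => gmul z.1 z.2) =
      (f \o mulG) \o (fun z => (g z.1, g z.2)).
    by apply/funext => w; rewrite /= mulE.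
  refine (@hol_map_at_comp _ (prod_space H H) (prod_space G G) H _
    (f \o mulG) z _ _); last first.
    apply: (@hol_map_at_comp _ _ G H); last exact: hf.
    by move: hmul => /(holomorphicP _ (manifold_sheaf mGG)); apply.
  apply: (hol_map_at_pair mG mG aHH).
    apply: (@hol_map_at_comp _ (prod_space H H) H G fst g z);
      [exact: hol_map_at_fst|exact: hg].
  apply: (@hol_map_at_comp _ (prod_space H H) H G snd g z);
    [exact: hol_map_at_snd|exact: hg].
- exists (f e); first by split=> a; rewrite mulE fK ?e1 ?e2 gK.
  exists (f \o i \o g); split.
  + apply/(holomorphicP _ (analytic_sheaf aH)) => z.
    apply: (@hol_map_at_comp _ _ G H); first exact: hg.
    apply: (@hol_map_at_comp _ _ G H); last exact: hf.
    by move: hi => /(holomorphicP _ (analytic_sheaf aG)); apply.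
  + by move=> a; rewrite mulE /= fK i1.
  + by move=> a; rewrite mulE /= fK i2.
Qed.

End LieTransport.

Section Covering.
Context {R : realType}.
Variables (X Y : hol_space R) (q : Y -> X).
Hypotheses (mX : complex_manifold X) (mY : complex_manifold Y).

(** V is a sheet of the covering over U, and s is the inverse of q on it. *)
Definition local_section (V : set Y) (U : set X) (s : X -> Y) :=
  [/\ open V /\ open U, forall x, U x -> V (s x) /\ q (s x) = x,
      forall y, V y -> U (q y) /\ s (q y) = y &
      forall x, U x -> hol_map_at s x].

Lemma covering_section (y0 : Y) : covering q ->
  exists V U s, local_section V U s /\ V y0.
Proof.
have aX := manifold_analytic mX; have aY := manifold_analytic mY.
move=> [hq cov]; have [U [oU Uq [S [Sdisj Scov Sbi]]]] := cov (q y0).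
have [V SV Vy0] : (\bigcup_(V in S) V) y0 by rewrite Scov.
have [oV [hV [hsub [g [hg gK gK']]]]] := Sbi V SV.
pose w : sub_space U := in_sub Uq.
pose s x := val (g (to_sub w x)).
have qs x : U x -> q (s x) = x.
  by move=> Ux; rewrite -[in RHS](to_subE w Ux) -[in RHS](gK' (to_sub w x)).
exists V, U, s; split=> //; split => //.
- by move=> x Ux; split; [exact: in_subP|exact: qs].
- move=> y Vy; split; first exact: (hV _ Vy).
  rewrite /s; suff -> : to_sub w (q y) = sub_map hV (in_sub Vy) by rewrite gK.
  by apply/val_inj; rewrite to_subE//; exact: (hV _ Vy).
- move=> x Ux; apply: (@hol_map_at_comp _ X (sub_space U) Y (to_sub w) (val \o g)).
    apply: (@hol_map_at_to_sub _ X X U w id) => //; first exact: hol_map_at_id.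
    exact: open_near.
  apply: (@hol_map_at_comp _ _ (sub_space V)); last exact: hol_map_at_val.
  move: hg => /(holomorphicP _ (analytic_sheaf (sub_analytic U aX))); exact.
Qed.

Lemma deck_hol_map_at (f : deck q) y : hol_map_at f y.
Proof.
have [hf _] := deck_bihol f.
by move: hf => /(holomorphicP _ (manifold_sheaf mY)); apply.
Qed.

(** The fixed points of f form an open set, because f and the identity lift q
    through the same sheet, and a closed one, because Y is Hausdorff. *)
Lemma deck_free (f : deck q) y : connected [set: Y] -> covering q ->
  f y = y -> forall y', f y' = y'.
Proof.
move=> cY cov fy.
pose S := [set y | f y = y].
have oS : open S.
  apply: open_pointwise => y1 /= fy1.
  have [V [U [s [[[oV oU] sU sV _] Vy1]]]] := covering_section y1 cov.
  have [cf _] := deck_hol_map_at f y1.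
  have H : \forall z \near y1, V (f z) by apply: cf; rewrite fy1; exact: open_near.
  apply: filterS2 (open_near oV Vy1) H => z Vz Vfz.
  rewrite /S /= -[LHS](sV _ Vfz).2 deck_over; exact: (sV z Vz).2.
have cS : closed S.
  rewrite -[S]setCK; apply: open_closedC; apply: open_pointwise => y1 /= nf.
  have hY : hausdorff_space Y by case: mY.
  have [A [B [oA oB Afy By AB]]] := (hausdorffP Y).1 hY _ _ nf.
  have [cf _] := deck_hol_map_at f y1.
  have H : \forall z \near y1, A (f z) by apply: cf; exact: open_near.
  apply: filterS2 (open_near oB By) H => z Bz Afz /= e.
  by apply: (AB z) => //; rewrite -e.
have ST : S = setT.
  apply: cY; first by exists y.
  - by exists S => //; rewrite setTI.
  - by exists S => //; rewrite setTI.
by move=> y'; have : S y' by rewrite ST.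
Qed.

Lemma galois_surj : galois_cover q -> forall x, exists y, q y = x.
Proof.
by move=> [_ _ [_ [g [_ _ gK]]]] x; exists (repr (g x)); exact: (gK x).
Qed.

(** Points of one fibre of q have the same class, as the quotient of Y maps
    injectively to X. *)
Lemma galois_trans : galois_cover q -> forall y y', q y = q y' ->
  exists f : deck q, f y = y'.
Proof.
move=> [_ _ [_ [g [_ gK _]]]] y y' qyy'.
pose p (z : Y) : quot_space (deck_equiv q) := \pi_({eq_quot (deck_equiv q)})%qT z.
have qp z : deck_quot_map (p z) = q z.
  rewrite /deck_quot_map /p.
  have /eqmodP/asboolP[f /= <-] : z = repr (\pi_({eq_quot (deck_equiv q)})%qT z)
    %[mod {eq_quot (deck_equiv q)}]%qT by rewrite reprK.
  by rewrite deck_over.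
have : p y = p y' by apply: (can_inj gK); rewrite !qp.
by move=> /eqmodP/asboolP.
Qed.

End Covering.

(** * Bundles trivialized over the covering *)

Lemma hol_map_at_comp_val (R : realType) (M N : hol_space R) (A : set M)
    (f : M -> N)
    (w : sub_space A) :
  hol_map_at f (val w) -> hol_map_at (fun v : sub_space A => f (val v)) w.
Proof.
by move=> hf; apply: (@hol_map_at_comp _ (sub_space A) M N val f w) => //;
  exact: hol_map_at_val.
Qed.

Section Morphisms.
Context {R : realType} (X : hol_space R).

Lemma bundle_mor_intro (E E' : fib_space X) (f : E -> E') : analytic_space E ->
  (forall z, hol_map_at f z) ->
  (forall z, proj (f z) = proj z) ->
  (forall x (a b : fibre E x) (a' b' : fibre E' x), val a' = f (val a) ->
    val b' = f (val b) ->
     val (gmul a' b') = f (val (gmul a b))) ->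
  bundle_mor f.
Proof.
move=> aE hf pf fM; split; first exact/(holomorphicP _ (analytic_sheaf aE)).
have hp : forall x z, (@proj _ X E @^-1` [set x]) z ->
  (@proj _ X E' @^-1` [set x]) (f z).
  by move=> x z; rewrite /= pf.
exists hp => x; split.
  by move=> a b; apply/val_inj; rewrite /= (fM x a b).
apply/(holomorphicP _ (analytic_sheaf (sub_analytic _ aE))) => a.
exact: (sub_map_hol (hp x) aE (fun z _ => hf z)).
Qed.

Lemma bundle_mor_elim (E E' : fib_space X) (f : E -> E') : analytic_space E ->
    bundle_mor f ->
  [/\ forall z, hol_map_at f z, forall z, proj (f z) = proj z &
  forall x (a b : fibre E x) (a' b' : fibre E' x), val a' = f (val a) ->
    val b' = f (val b) ->
     val (gmul a' b') = f (val (gmul a b))].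
Proof.
move=> aE [hf [hp fM]]; split.
- exact/(holomorphicP _ (analytic_sheaf aE)).
- by move=> z; exact: (hp (proj z)).
- move=> x a b a' b' ea eb; have [/(_ a b) + _] := fM x.
  have -> : a' = sub_map (hp x) a by exact/val_inj.
  have -> : b' = sub_map (hp x) b by exact/val_inj.
  by move=> <-.
Qed.

(** The inverse of a fibrewise bijective homomorphism is a homomorphism, so
    only its holomorphy is to be checked. *)
Lemma bundle_iso_intro (E E' : fib_space X) (f : E -> E') (g : E' -> E) :
  analytic_space E -> analytic_space E' -> bundle_mor f ->
    (forall z, hol_map_at g z) ->
  cancel f g -> cancel g f -> bundle_iso E E'.
Proof.
move=> aE aE' mf hg fK gK; have [hf pf fM] := bundle_mor_elim aE mf.
exists f, g; split => //.
apply: bundle_mor_intro => // [z|x a b a' b' ea eb].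
  by rewrite -pf gK.
apply: (can_inj fK); rewrite gK.
by rewrite -(fM x a' b' a b) // ?ea ?eb gK.
Qed.

End Morphisms.

Section Trivialized.
Context {R : realType}.
Variables (X Y : hol_space R) (q : Y -> X) (G : grp_space R).
Hypotheses (manX : complex_manifold X) (manY : complex_manifold Y).
Hypotheses (galq : galois_cover q) (lieG : complex_lie_group G).

Let manG : complex_manifold G. Proof. by case: lieG. Qed.
Let anaX : analytic_space X. Proof. exact: manifold_analytic. Qed.
Let anaY : analytic_space Y. Proof. exact: manifold_analytic. Qed.
Let anaG : analytic_space G. Proof. exact: manifold_analytic. Qed.
Let manYG : complex_manifold (prod_space Y G). Proof. exact: prod_manifold. Qed.
Let anaYG : analytic_space (prod_space Y G). Proof. exact: manifold_analytic. Qed.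
Let covq : covering q. Proof. by case: galq. Qed.
Let hq y : hol_map_at q y.
Proof.
by case: covq => + _ => /(holomorphicP _ (manifold_sheaf manY)); apply.
Qed.

(** A trivialization of the pullback of E, as functions on Y x G and on pairs
    (y, e) with q y = proj e.  As B y e is meaningless for other pairs, its
    holomorphy is required after substitution of maps into such pairs. *)
Record trivialized (E : fib_space X) (A : Y -> G -> E) (B : Y -> E ->
    G) : Prop := Trivialized {
  triv_proj : forall y g, proj (A y g) = q y ;
  triv_hol : forall z, hol_map_at (fun z : prod_space Y G => A z.1 z.2) z ;
  triv_K : forall y g, B y (A y g) = g ;
  triv_KV : forall y e, q y = proj e -> A y (B y e) = e ;
  triv_holV : forall (M : hol_space R) (f : M -> Y) (e : M -> E) (m : M),
    analytic_space M -> hol_map_at f m -> hol_map_at e m ->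
    (\forall m' \near m, q (f m') = proj (e m')) ->
    hol_map_at (fun m' => B (f m') (e m')) m ;
  triv_mul : forall x y g h (a b : fibre E x), val a = A y g -> val b = A y h ->
    val (gmul a b) = A y (gmul g h) }.

Section OneBundle.
Variables (E : fib_space X) (manE : complex_manifold E).
Hypothesis hproj : forall e, hol_map_at (@proj _ X E) e.
Let anaE : analytic_space E. Proof. exact: manifold_analytic. Qed.
Variables (A : Y -> G -> E) (B : Y -> E -> G) (pE : trivialized A B).

Let AP := triv_proj pE.
Let BK := triv_K pE.
Let AK := triv_KV pE.

Lemma triv_comp (M : hol_space R) (f : M -> Y) (g : M -> G) (m : M) :
  analytic_space M -> hol_map_at f m -> hol_map_at g m ->
    hol_map_at (fun m' => A (f m') (g m')) m.
Proof.
move=> aM hf hg.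
refine (@hol_map_at_comp _ M (prod_space Y G) E (fun m' => (f m',
  g m')) (fun z => A z.1 z.2) m _ _).
  exact: hol_map_at_pair.
exact: (triv_hol pE).
Qed.

Lemma triv_mulV x y (a b : fibre E x) : q y = x ->
  B y (val (gmul a b)) = gmul (B y (val a)) (B y (val b)).
Proof.
move=> qy; have pa (c : fibre E x) : q y = proj (val c) by rewrite (in_subP c).
have := @triv_mul _ _ _ pE x y (B y (val a)) (B y (val b)) a b.
by rewrite !AK => [/(_ erefl erefl) ->|//|//]; rewrite BK.
Qed.

Lemma triv_fibre_lie y0 x : q y0 = x -> complex_lie_group (fibre E x).
Proof.
move=> qy0.
have Ax g : (@proj _ X E @^-1` [set x]) (A y0 g) by rewrite /= AP.
pose j (g : G) : fibre E x := in_sub (Ax g).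
pose j' (c : fibre E x) : G := B y0 (val c).
have hj g : hol_map_at j g.
  apply: hol_map_at_sub => //.
  apply: triv_comp => //; [exact: hol_map_at_cst|exact: hol_map_at_id].
have aF : analytic_space (fibre E x) := sub_analytic _ anaE.
have hj' c : hol_map_at j' c.
  apply: (triv_holV pE) => //; first exact: hol_map_at_cst.
    exact: hol_map_at_val.
  by near=> v; rewrite qy0 (in_subP v).
have jK : cancel j j' by move=> g; exact: BK.
have jKV : cancel j' j by move=> c; apply/val_inj; rewrite /= AK// qy0 (in_subP c).
apply: (lie_group_transport hj hj') => //.
  move=> g h; apply/val_inj => /=.
  by rewrite (@triv_mul _ _ _ pE x y0 g h).
exact: (biholo_manifold hj hj').
Unshelve. all: by end_near. Qed.

(** Over an open U with a section s of q, the fibre over x' is carried to the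
    fibre over x by A (s x) o B (s x'). *)
Lemma triv_group_bundle : group_bundle E.
Proof.
split.
- exact: manE.
- exact/(holomorphicP _ (manifold_sheaf manE)).
- by move=> x; have [y qy] := galois_surj galq x; exact: triv_fibre_lie qy.
move=> x; have [y0' qy0'] := galois_surj galq x.
have [V [U [s [[[oV oU] sU sV hs] Vy0']]]] := covering_section manX manY y0' covq.
have Ux : U x by rewrite -qy0'; exact: (sV _ Vy0').1.
pose y0 := s x; have qy0 : q y0 = x by exact: (sU x Ux).2.
exists U; split => //.
have lieF := triv_fibre_lie qy0.
have manF : complex_manifold (fibre E x) by case: lieF.
have manU := open_sub_manifold oU manX.
have anaPU : analytic_space (sub_space (@proj _ X E @^-1` U)) :=
  sub_analytic _ anaE.
have Ax g : (@proj _ X E @^-1` [set x]) (A y0 g) by rewrite /= AP.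
have PU (z : sub_space (@proj _ X E @^-1` U)) : U (proj (val z)).
  by exact: (in_subP z).
pose Phi (z : sub_space (@proj _ X E @^-1` U)) : prod_space (sub_space U)
  (fibre E x) :=
  (in_sub (PU z), in_sub (Ax (B (s (proj (val z))) (val z)))).
have AU (w : prod_space (sub_space U) (fibre E x)) :
    (@proj _ X E @^-1` U) (A (s (val w.1)) (B y0 (val w.2))).
  by rewrite /= AP (sU _ (in_subP w.1)).2; exact: (in_subP w.1).
pose Psi w : sub_space (@proj _ X E @^-1` U) := in_sub (AU w).
have manP := prod_manifold manU manF.
have anaP := manifold_analytic manP.
have hPhi z : hol_map_at Phi z.
  apply: (hol_map_at_pair manU manF anaPU).
    apply: hol_map_at_sub => //.
    exact: hol_map_at_comp_val.
  apply: hol_map_at_sub => //.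
  apply: triv_comp => //; first exact: hol_map_at_cst.
  apply: (triv_holV pE) => //.
  - apply: (@hol_map_at_comp_val _ E Y _ (fun e => s (proj e))).
    refine (@hol_map_at_comp _ E X Y (@proj _ X E) s (val z) _ _);
      first exact: hproj.
    exact: (hs _ (PU z)).
  - exact: hol_map_at_val.
  - by near=> v; rewrite (sU _ (PU v)).2.
have hPsi w : hol_map_at Psi w.
  apply: hol_map_at_sub => //.
  apply: triv_comp => //.
    refine (@hol_map_at_comp _ (prod_space _ _) (sub_space U) Y fst (fun u => s
      (val u)) w _ _); last first.
      by apply: hol_map_at_comp_val; exact: (hs _ (in_subP w.1)).
    exact: (hol_map_at_fst manU manF).
  apply: (triv_holV pE) => //; first exact: hol_map_at_cst.
    refine (@hol_map_at_comp _ (prod_space _ _) (fibre E x) E snd val w _ _);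
      last exact: hol_map_at_val.
    exact: (hol_map_at_snd manU manF).
  by near=> v; rewrite qy0 (in_subP v.2).
have PhiK : cancel Phi Psi.
  by move=> z; apply/val_inj; rewrite /= BK AK// (sU _ (PU z)).2.
have PsiK : cancel Psi Phi.
  move=> [u c]; congr pair; apply/val_inj => /=.
    by rewrite AP (sU _ (in_subP u)).2.
  have -> : s (proj (A (s (val u)) (B y0 (val c)))) = s (val u).
    by rewrite AP (sU _ (in_subP u)).2.
  by rewrite BK AK// qy0 (in_subP c).
exists Phi; split.
- split; first exact/(holomorphicP _ (analytic_sheaf anaPU)).
  exists Psi; split; [|exact: PhiK|exact: PsiK].
  exact/(holomorphicP _ (analytic_sheaf anaP)).
- by [].
move=> y Uy; have qsy := (sU y Uy).2.
have Ay g : (@proj _ X E @^-1` [set y]) (A (s y) g) by rewrite /= AP.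
pose t (a : fibre E y) : fibre E x := in_sub (Ax (B (s y) (val a))).
pose t' (a : fibre E x) : fibre E y := in_sub (Ay (B y0 (val a))).
have -> : (fun a => (Phi (sub_map (fibre_sub Uy) a)).2) = t.
  by apply/funext => a; apply/val_inj => /=; rewrite [proj _](in_subP a).
have aF : analytic_space (fibre E x) := sub_analytic _ anaE.
have aFy : analytic_space (fibre E y) := sub_analytic _ anaE.
split.
  move=> a b; apply/val_inj; rewrite /= (triv_mulV _ _ qsy).
  by rewrite (@triv_mul _ _ _ pE x y0 (B (s y) (val a)) (B (s y) (val b))).
split.
  apply/(holomorphicP _ (analytic_sheaf aFy)) => a; apply: hol_map_at_sub => //.
  apply: triv_comp => //; first exact: hol_map_at_cst.
  apply: (triv_holV pE) => //; first exact: hol_map_at_cst.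
    exact: hol_map_at_val.
  by near=> v; rewrite qsy (in_subP v).
exists t'; split.
- apply/(holomorphicP _ (analytic_sheaf aF)) => a; apply: hol_map_at_sub => //.
  apply: triv_comp => //; first exact: hol_map_at_cst.
  apply: (triv_holV pE) => //; first exact: hol_map_at_cst.
    exact: hol_map_at_val.
  by near=> v; rewrite qy0 (in_subP v).
- by move=> a; apply/val_inj; rewrite /= BK AK// qsy (in_subP a).
- by move=> a; apply/val_inj; rewrite /= BK AK// qy0 (in_subP a).
Unshelve. all: by end_near. Qed.

Lemma triv_pullback_iso : bundle_iso (pull_bundle q E) (triv_bundle Y G).
Proof.
have manYE := prod_manifold manY manE.
have anaP : analytic_space (pull_bundle q E) :=
  sub_analytic _ (manifold_analytic manYE).
pose f (w : pull_bundle q E) : triv_bundle Y G :=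
  ((val w).1, B (val w).1 (val w).2).
have Aq (z : triv_bundle Y G) : pull_set q (z.1,
  A z.1 z.2) by rewrite /pull_set /= AP.
pose g (z : triv_bundle Y G) : pull_bundle q E := in_sub (Aq z).
have h1 (w : pull_bundle q E) : hol_map_at (fun w : pull_bundle q E => (val w).1) w.
  by apply: (@hol_map_at_comp_val _ (prod_space Y E)); exact: hol_map_at_fst.
have h2 (w : pull_bundle q E) : hol_map_at (fun w : pull_bundle q E => (val w).2) w.
  by apply: (@hol_map_at_comp_val _ (prod_space Y E)); exact: hol_map_at_snd.
apply: (@bundle_iso_intro _ _ _ _ f g) => //.
- apply: bundle_mor_intro => //.
  + move=> w; apply: (hol_map_at_pair manY manG anaP); first exact: h1.
    apply: (triv_holV pE) => //.
    by near=> v; exact: (in_subP v).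
  + move=> y a b [[y1 g1] /= y1y] [[y2 g2] /= y2y] /= [e1 e1'] [e2 e2'].
    have ya : (val (val a)).1 = y by exact: (in_subP a).
    have yb : (val (val b)).1 = y by exact: (in_subP b).
    congr pair.
    rewrite (@triv_mulV (q y) y) //= e1' e2'.
    by rewrite ya yb.
- move=> z; apply: hol_map_at_sub => //.
  apply: (hol_map_at_pair manY manE anaYG); first exact: hol_map_at_fst.
  exact: (triv_hol pE).
- move=> w; apply/val_inj => /=; rewrite AK; first by case: (val w).
  exact: (in_subP w).
- by move=> [y h]; rewrite /f /= BK.
Unshelve. all: by end_near. Qed.

End OneBundle.

End Trivialized.

(** * Crossed morphisms and isomorphisms *)

Section Cocycles.
Context {R : realType}.
Variables (X Y : hol_space R) (q : Y -> X) (G : grp_space R).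
Hypotheses (manX : complex_manifold X) (manY : complex_manifold Y).
Hypotheses (galq : galois_cover q) (lieG : complex_lie_group G).

Let manG : complex_manifold G. Proof. by case: lieG. Qed.
Let anaX : analytic_space X. Proof. exact: manifold_analytic. Qed.
Let anaY : analytic_space Y. Proof. exact: manifold_analytic. Qed.
Let anaG : analytic_space G. Proof. exact: manifold_analytic. Qed.
Let manYG : complex_manifold (prod_space Y G). Proof. exact: prod_manifold. Qed.
Let anaYG : analytic_space (prod_space Y G). Proof. exact: manifold_analytic. Qed.
Let covq : covering q. Proof. by case: galq. Qed.

Lemma hol_map_at_fiber (M : hol_space R) (y : Y) (f : prod_space Y G -> M) (g : G) :
  (forall z, hol_map_at f z) -> hol_map_at (fun g => f (y, g)) g.
Proof.
move=> hf; apply: (@hol_map_at_comp _ G (prod_space Y G) M (fun g => (y,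
  g)) f g); last exact: hf.
by apply: (hol_map_at_pair manY manG anaG);
  [exact: hol_map_at_cst|exact: hol_map_at_id].
Qed.

(** Holomorphy of the inverses is required only for each y separately; see
    [aut_maps_inv_hol_map_at]. *)
Lemma aut_maps_exists (l l' : Y -> G -> G) :
  (forall y, {morph l y : a b / gmul a b}) ->
    (forall y, {morph l' y : a b / gmul a b}) ->
  (forall z, hol_map_at (fun z : prod_space Y G => l z.1 z.2) z) ->
  (forall y g, hol_map_at (l' y) g) ->
  (forall y, cancel (l y) (l' y)) -> (forall y, cancel (l' y) (l y)) ->
  exists m : aut_maps Y G, forall y, (m y =1 l y) /\ (aut_inv (m y) =1 l' y).
Proof.
move=> lM lM' hl hl' lK lK'.
have ll y : lie_hom (l y).
  split; first exact: lM.
  apply/(holomorphicP _ (analytic_sheaf anaG)) => g.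
  exact: (hol_map_at_fiber y g hl).
have ll' y : lie_hom (l' y).
  by split; [exact: lM'|exact/(holomorphicP _ (analytic_sheaf anaG))].
pose La y : lie_aut G := LieAut (ll y) (ll' y) (lK y) (lK' y).
have hm : holomorphic (fun z : prod_space Y G => La z.1 z.2 : G).
  exact/(holomorphicP _ (analytic_sheaf anaYG)).
by exists (@AutMaps _ Y G La hm) => y; split.
Qed.

Lemma aut_maps_hol_map_at (m : aut_maps Y G) z :
  hol_map_at (fun z : prod_space Y G => m z.1 z.2) z.
Proof. by have := maps_hol m => /(holomorphicP _ (analytic_sheaf anaYG));
  apply. Qed.

(** This makes Maps(Y, Aut(G)) a group. *)
Lemma aut_maps_inv_hol_map_at (m : aut_maps Y G) z :
  hol_map_at (fun z : prod_space Y G => aut_inv (m z.1) z.2) z.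
Proof.
move: z; apply/(holomorphicP _ (analytic_sheaf anaYG)).
apply: (@family_inv_hol _ _ _ manY manG _ (fun y => aut_inv (m y)) (maps_hol m)).
- by move=> y; have [] := aut_inv_hom (m y).
- by move=> y g; exact: (aut_funK (m y)).
- by move=> y g; exact: (aut_invK (m y)).
Qed.

Section Cocycle.
Variables (E : fib_space X).
Variables (A : Y -> G -> E) (B : Y -> E -> G) (pE : trivialized q A B).

Let AP := triv_proj pE.
Let BK := triv_K pE.
Let AK := triv_KV pE.

Definition is_cocycle (phi : crossed q G) :=
  forall f y g, phi f y g = B (f y) (A y g).

Lemma transition_morph y y' : q y = q y' ->
  {morph (fun g => B y' (A y g)) : a b / gmul a b}.
Proof.
move=> qyy' g h.
have Ay k : (@proj _ X E @^-1` [set q y]) (A y k) by rewrite /= AP.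
pose a : fibre E (q y) := in_sub (Ay g); pose b : fibre E (q y) := in_sub (Ay h).
rewrite -(@triv_mul _ _ _ _ _ _ _ _ pE _ y g h a b)//.
by rewrite (triv_mulV pE _ _ (esym qyy')).
Qed.

Lemma transitionK y y' : q y = q y' ->
  cancel (fun g => B y' (A y g)) (fun g => B y (A y' g)).
Proof. by move=> qyy' g; rewrite AK ?BK// AP. Qed.

Lemma cocycle_exists : exists phi : crossed q G, is_cocycle phi.
Proof.
have qf (f : deck q) y : q y = q (f y) by rewrite deck_over.
have [m mP] : exists m : deck q ->
  aut_maps Y G, forall f y g, m f y g = B (f y) (A y g).
  have H (f : deck q) : exists m : aut_maps Y G, forall y g,
    m y g = B (f y) (A y g).
    have [||||||m mP] := @aut_maps_exists (fun y g => B (f y) (A y g))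
      (fun y g => B y (A (f y) g)).
    - by move=> y; exact: transition_morph.
    - by move=> y; apply: transition_morph.
    - move=> z; apply: (triv_holV pE) => //.
      + refine (@hol_map_at_comp _ (prod_space Y G) Y Y fst f z _ _);
        last exact: deck_hol_map_at.
        exact: hol_map_at_fst.
      + exact: (triv_hol pE).
      + by near=> v; rewrite AP.
    - move=> y g; apply: (triv_holV pE) => //; first exact: hol_map_at_cst.
        by apply: (triv_comp manY lieG pE) => //;
          [exact: hol_map_at_cst|exact: hol_map_at_id].
      by near=> v; rewrite AP.
    - by move=> y; exact: transitionK.
    - by move=> y; exact: transitionK.
    by exists m => y g; have [-> _] := mP y.
  by have [m mP] := choice H; exists m.
have cP (f1 f2 : deck q) y : m (deck_comp f1 f2) y =1 m f1 (f2 y) \o m f2 y.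
  by move=> g; rewrite /= !mP /= AK// AP.
by exists (Crossed cP) => f y g; exact: mP.
Unshelve. all: by end_near. Qed.

End Cocycle.

Section Glue.
Variables (E : fib_space X) (manE : complex_manifold E).
Hypothesis hproj : forall e, hol_map_at (@proj _ X E) e.
Variables (A : Y -> G -> E) (B : Y -> E -> G) (pE : trivialized q A B).
Variables (E' : fib_space X) (A' : Y -> G -> E') (B' : Y -> E' -> G).
Hypothesis pE' : trivialized q A' B'.
Let anaE : analytic_space E. Proof. exact: manifold_analytic. Qed.

Variable l : Y -> G -> G.
Hypothesis hl : forall z, hol_map_at (fun z : prod_space Y G => l z.1 z.2) z.
Hypothesis lM : forall y, {morph l y : a b / gmul a b}.
Hypothesis lE : forall (f : deck q) y g,
  l (f y) (B (f y) (A y g)) = B' (f y) (A' y (l y g)).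

Let ysec x := projT1 (cid (galois_surj galq x)).
Let ysecP x : q (ysec x) = x. Proof. exact: (projT2 (cid
  (galois_surj galq x))). Qed.

(** The map that is l y in the coordinates over y, read at a chosen y over the
    base point of e. *)
Definition glue (e : E) : E' :=
  let y := ysec (proj e) in A' y (l y (B y e)).

(** Two choices of y differ by a deck transformation, and l is equivariant for
    the two crossed morphisms. *)
Lemma glueE y e : q y = proj e -> glue e = A' y (l y (B y e)).
Proof.
move=> qy; rewrite /glue; set y' := ysec _.
have qy' : q y' = q y by rewrite ysecP.
have [f fy] := galois_trans galq qy'.
rewrite -fy; set g := B y' e.
have -> : e = A y' g by rewrite (triv_KV pE)// qy'.
rewrite lE (triv_KV pE')// (triv_proj pE') deck_over//.
Qed.

Lemma glue_proj e : proj (glue e) = proj e.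
Proof. by rewrite /glue (triv_proj pE') ysecP. Qed.

(** Near e, the chosen point of the fibre may be replaced by a local section
    of q. *)
Lemma glue_hol_map_at e : hol_map_at glue e.
Proof.
have [V [U [s [[[oV oU] sU sV hs] Vy0]]]] :=
  covering_section manX manY (ysec (proj e)) covq.
have Ue : U (proj e) by rewrite -[proj e]ysecP; exact: (sV _ Vy0).1.
have [cp _] := hproj e.
have Unear : \forall e' \near e, U (proj e') := cp _ (open_near oU Ue).
have hse : hol_map_at (fun e => s (proj e)) e.
  refine (@hol_map_at_comp _ E X Y (@proj _ X E) s e _ _); first exact: hproj.
  exact: (hs _ Ue).
apply: (@hol_map_at_eq _ _ _ (fun e => A' (s (proj e)) (l (s (proj e)) (B (s
  (proj e)) e)))) => //.
  by apply: filterS Unear => e' Ue'; rewrite (glueE (sU _ Ue').2).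
apply: (triv_comp manY lieG pE') => //.
refine (@hol_map_at_comp _ E (prod_space Y G) G (fun e => (s (proj e),
  B (s (proj e)) e)) (fun z => l z.1 z.2) e _ _); last exact: hl.
apply: (hol_map_at_pair manY manG anaE) => //.
apply: (triv_holV pE) => //; first exact: hol_map_at_id.
by apply: filterS Unear => e' Ue'; rewrite (sU _ Ue').2.
Qed.

Lemma glue_mor : bundle_mor glue.
Proof.
apply: bundle_mor_intro => //.
- exact: glue_hol_map_at.
- exact: glue_proj.
move=> x a b a' b'; have qx := ysecP x.
have qP (c : fibre E x) : q (ysec x) = proj (val c) by rewrite (in_subP c).
rewrite !(glueE (qP _)) => ea eb.
rewrite (@triv_mul _ _ _ _ _ _ _ _ pE' _ _ _ _ _ _ ea eb).
by rewrite (triv_mulV pE _ _ qx) lM.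
Qed.

End Glue.

Lemma bundle_iso_of_aut_maps (E E' : fib_space X)
    (A : Y -> G -> E) (B : Y -> E -> G) (A' : Y -> G -> E') (B' : Y -> E' -> G)
    (l : aut_maps Y G) :
  complex_manifold E -> complex_manifold E' ->
  (forall e, hol_map_at (@proj _ X E) e) ->
    (forall e, hol_map_at (@proj _ X E') e) ->
  trivialized q A B -> trivialized q A' B' ->
  (forall (f : deck q) y g, l (f y) (B (f y) (A y g)) = B' (f y) (A' y (l y g))) ->
  bundle_iso E E'.
Proof.
move=> mE mE' hp hp' pE pE' lE.
pose li y := aut_inv (l y).
have liE (f : deck q) y g : li (f y) (B' (f y) (A' y g)) = B (f y) (A y (li y g)).
  rewrite /li -[in LHS](aut_invK (l y) g) -lE.
  exact: (aut_funK (l (f y))).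
have lM y : {morph l y : a b / gmul a b} by have [] := aut_hom (l y).
have gm := glue_mor mE hp pE pE' (aut_maps_hol_map_at l) lM lE.
have hg' := glue_hol_map_at mE' hp' pE' pE (aut_maps_inv_hol_map_at l) liE.
apply: (bundle_iso_intro _ _ gm hg').
- exact: manifold_analytic.
- exact: manifold_analytic.
- move=> e; have [y qy] := galois_surj galq (proj e).
  have qy' := etrans qy (esym (glue_proj B pE' (fun y => l y) e)).
  rewrite (glueE pE' pE liE qy') (glueE pE pE' lE qy).
  by rewrite (triv_K pE') /li aut_funK (triv_KV pE).
- move=> e; have [y qy] := galois_surj galq (proj e).
  have qy' := etrans qy (esym (glue_proj B' pE li e)).
  rewrite (glueE pE pE' lE qy') (glueE pE' pE liE qy).
  by rewrite (triv_K pE) /li aut_invK (triv_KV pE').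
Qed.

Lemma aut_maps_of_bundle_iso (E E' : fib_space X)
    (A : Y -> G -> E) (B : Y -> E -> G) (A' : Y -> G -> E') (B' : Y -> E' -> G) :
  complex_manifold E -> complex_manifold E' ->
  trivialized q A B -> trivialized q A' B' -> bundle_iso E E' ->
  exists l : aut_maps Y G,
    forall (f : deck q) y g, l (f y) (B (f y) (A y g)) = B' (f y) (A' y (l y g)).
Proof.
move=> mE mE' pE pE' [F [F' [mF mF' FK FK']]].
have aE := manifold_analytic mE; have aE' := manifold_analytic mE'.
have [hF pF FM] := bundle_mor_elim aE mF.
have [hF' pF' FM'] := bundle_mor_elim aE' mF'.
have mor (E1 E2 : fib_space X) A1 B1 A2 B2 (H : E1 -> E2) :
    trivialized q A1 B1 -> trivialized q A2 B2 -> (forall z, proj (H z) = proj z) ->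
    (forall x (a b : fibre E1 x) (a' b' : fibre E2 x), val a' = H (val a) ->
       val b' = H (val b) -> val (gmul a' b') = H (val (gmul a b))) ->
    forall y, {morph (fun g => B2 y (H (A1 y g)) : G) : a b / gmul a b}.
  move=> p1 p2 pH HM y g h.
  have A1y k : (@proj _ X E1 @^-1` [set q y]) (A1 y k) by rewrite /= (triv_proj p1).
  have A2y k : (@proj _ X E2 @^-1` [set q y]) (H (A1 y k)).
    by rewrite /= pH (triv_proj p1).
  pose a : fibre E1 (q y) := in_sub (A1y g);
    pose b : fibre E1 (q y) := in_sub (A1y h).
  pose a' : fibre E2 (q y) := in_sub (A2y g);
    pose b' : fibre E2 (q y) := in_sub (A2y h).
  rewrite -(@triv_mul _ _ _ _ _ _ _ _ p1 _ y g h a b)//.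
  by rewrite -(HM _ a b a' b')// (triv_mulV p2).
have [||||||l lP] := @aut_maps_exists (fun y g => B' y (F (A y g)))
  (fun y g => B y (F' (A' y g))).
- exact: mor pE pE' pF FM.
- exact: mor pE' pE pF' FM'.
- move=> z; apply: (triv_holV pE') => //; first exact: hol_map_at_fst.
    refine (@hol_map_at_comp _ _ E E' _ F z _ _); last exact: hF.
    exact: (triv_hol pE).
  by near=> v; rewrite pF (triv_proj pE).
- move=> y g; apply: (triv_holV pE) => //; first exact: hol_map_at_cst.
    refine (@hol_map_at_comp _ _ E' E _ F' g _ _); last exact: hF'.
    by apply: (triv_comp manY lieG pE') => //;
      [exact: hol_map_at_cst|exact: hol_map_at_id].
  by near=> v; rewrite pF' (triv_proj pE').
- by move=> y g; rewrite (triv_KV pE') ?FK ?(triv_K pE)// pF (triv_proj pE).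
- by move=> y g; rewrite (triv_KV pE) ?FK' ?(triv_K pE')// pF' (triv_proj pE').
exists l => f y g; have [-> _] := lP (f y); have [-> _] := lP y.
rewrite (triv_KV pE) ?(triv_KV pE')//.
  by rewrite pF (triv_proj pE).
by rewrite (triv_proj pE) deck_over.
Unshelve. all: by end_near. Qed.

End Cocycles.

(** * The quotient bundle of a crossed morphism *)

Section Quotient.
Context {R : realType}.
Variables (X Y : hol_space R) (q : Y -> X) (G : grp_space R).
Hypotheses (manX : complex_manifold X) (manY : complex_manifold Y).
Hypotheses (galq : galois_cover q) (lieG : complex_lie_group G).

Let manG : complex_manifold G. Proof. by case: lieG. Qed.
Let anaX : analytic_space X. Proof. exact: manifold_analytic. Qed.
Let anaY : analytic_space Y. Proof. exact: manifold_analytic. Qed.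
Let anaG : analytic_space G. Proof. exact: manifold_analytic. Qed.
Let manYG : complex_manifold (prod_space Y G). Proof. exact: prod_manifold. Qed.
Let anaYG : analytic_space (prod_space Y G). Proof. exact: manifold_analytic. Qed.
Let covq : covering q. Proof. by case: galq. Qed.
Let cY : connected [set: Y]. Proof. by case: galq. Qed.
Let hq y : hol_map_at q y.
Proof.
by case: covq => + _ => /(holomorphicP _ (manifold_sheaf manY)); apply.
Qed.

Lemma piG_trivialized (E : fib_space X) : complex_manifold E ->
  bundle_iso (pull_bundle q E) (triv_bundle Y G) ->
  exists A B, @trivialized R X Y q G E A B.
Proof.
move=> manE [f [g [mf mg fK gK]]].
have manYE := prod_manifold manY manE.
have anaP : analytic_space (pull_bundle q E) :=
  sub_analytic _ (manifold_analytic manYE).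
have [hf pf _] := bundle_mor_elim anaP mf.
have [hg pg gM] := bundle_mor_elim (E := triv_bundle Y G) anaYG mg.
have [e0 _] : exists e0 : G, True by case: lieG => _ _ _ [e0 _ _]; exists e0.
pose A y (k : G) : E := (val (g (y, k))).2.
pose B y (e : E) : G := if pselect (pull_set q (y,
  e)) is left H then (f (in_sub H)).2 else e0.
have gE y k : val (g (y, k)) = (y, A y k).
  by rewrite [LHS]surjective_pairing; congr pair; exact: (pg (y, k)).
have BE (w : pull_bundle q E) y e : val w = (y, e) -> B y e = (f w).2.
  move=> we; rewrite /B; case: pselect => [H|nH].
    by congr (f _).2; apply/val_inj; rewrite /= we.
  by case: nH; rewrite -we; exact: (in_subP w).
have Aq y k : q y = proj (A y k).
  by have := in_subP (g (y, k)); rewrite gE.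
exists A, B; split.
- by move=> y k; rewrite -Aq.
- move=> z; have -> : (fun z : prod_space Y G => A z.1 z.2) = (fun z => (val
  (g z)).2).
    by apply/funext => -[y k].
  refine (@hol_map_at_comp _ (prod_space Y G) (pull_bundle q E) E g (fun w =>
    (val w).2) z _ _).
    exact: hg.
  by apply: (@hol_map_at_comp_val _ (prod_space Y E)); exact: hol_map_at_snd.
- by move=> y k; rewrite (BE (g (y, k))) ?gE// gK.
- move=> y e qye; pose w : pull_bundle q E :=
  @in_sub _ (@pull_set _ X Y q E) (y, e) qye.
  have w1 : (f w).1 = y by exact: (pf w).
  rewrite (BE w)// /A -[in g _]w1 -surjective_pairing fK //.
- move=> M h e m aM hh he hqe.
  have Hm : pull_set q (h m, e m) := nbhs_singleton hqe.
  pose w : pull_bundle q E := in_sub Hm.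
  apply: (@hol_map_at_eq _ _ _ (fun m' => (f (to_sub w (h m', e m'))).2)) => //.
    apply: filterS hqe => m' qm'; rewrite (BE (to_sub w (h m', e m')))//.
    by rewrite to_subE.
  refine (@hol_map_at_comp _ M (prod_space Y G) G (fun m' => f (to_sub w (h m',
    e m'))) snd m _ _); last exact: hol_map_at_snd.
  refine (@hol_map_at_comp _ M (pull_bundle q E) (prod_space Y G)
    (fun m' => to_sub w (h m', e m')) f m _ _); last exact: hf.
  apply: (@hol_map_at_to_sub _ (prod_space Y E)) => //.
  exact: hol_map_at_pair.
- move=> x y k l a b ea eb.
  have xq : x = q y by rewrite (Aq y k) -ea; exact: (esym (in_subP a)).
  subst x.
  have Py k' : (@pull_proj _ _ _ q E @^-1` [set y]) (g (y,
    k')) by rewrite /= /pull_proj gE.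
  pose a' : fibre (pull_bundle q E) y := in_sub (Py k).
  pose b' : fibre (pull_bundle q E) y := in_sub (Py l).
  pose at_ : fibre (triv_bundle Y G) y :=
    @in_sub (Y * G) (fst @^-1` [set y]) (y, k) erefl.
  pose bt : fibre (triv_bundle Y G) y :=
    @in_sub (Y * G) (fst @^-1` [set y]) (y, l) erefl.
  have := gM y at_ bt a' b' erefl erefl.
  move=> /(congr1 (fun w => (val w).2)) /=.
  rewrite -[X in _ = X]/(A y (gmul k l)) => <-.
  have -> : in_sub (pull_fibreP a') = a by apply/val_inj; rewrite /= ea.
  by have -> : in_sub (pull_fibreP b') = b by apply/val_inj; rewrite /= eb.
Qed.

Section Twist.
Variable phi : crossed q G.
Local Notation P := (prod_space Y G).
Local Notation Q := (twist_quot phi).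
Local Notation p := (twist_pi phi).

Lemma twist_piP z z' : p z = p z' <-> exists f : deck q, twist phi f z = z'.
Proof.
split; first by move=> /eqmodP/asboolP.
by move=> H; apply/eqmodP/asboolP.
Qed.

Lemma twist_pi_surj c : exists z, p z = c.
Proof. by exists (repr c); exact: reprK. Qed.

Lemma twist_hol_map_at (f : deck q) z : hol_map_at (twist phi f) z.
Proof.
apply: (hol_map_at_pair manY manG anaYG).
  refine (@hol_map_at_comp _ P Y Y fst f z _ _); first exact: hol_map_at_fst.
  exact: deck_hol_map_at.
exact: (aut_maps_hol_map_at manY lieG).
Qed.

Lemma twist_pi_continuous : continuous p.
Proof. exact: pi_continuous. Qed.

Lemma twist_pi_hol_map_at z : hol_map_at p z.
Proof.
split; first exact: twist_pi_continuous.
move=> u [W [oW Wz hW]]; exists (p @^-1` W); split; [|exact: Wz|exact: hW].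
by move/continuousP: twist_pi_continuous; exact.
Qed.

(** The preimage of the image of O is the union of its translates. *)
Lemma twist_pi_open O : open O -> open (p @` O).
Proof.
move=> oO; suff : open (p @^-1` (p @` O)) by [].
apply: open_pointwise => z [z' Oz' /esym/twist_piP[f fz]].
have [cf _] := twist_hol_map_at f z.
have H : \forall w \near z, O (twist phi f w) by apply: cf; rewrite fz;
  exact: (open_near oO Oz').
apply: filterS H => w Ow; exists (twist phi f w) => //.
by apply/esym/twist_piP; exists f.
Qed.

(** Since only the identity fixes a point of Y, no other element of the group
    identifies points of {y} x G. *)
Lemma twist_free (f : deck q) y g h : f y = y -> twist phi f (y, g) = (y, h) ->
    g = h.
Proof.
move=> fy; rewrite twist_id; first by case.
by move=> y'; exact: (deck_free manX manY cY covq fy).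
Qed.

Lemma twist_pi_inj y : injective (fun g => p (y, g)).
Proof.
move=> g h /twist_piP[f fgh]; apply: (@twist_free f y) => //.
by have := congr1 fst fgh.
Qed.

Lemma twist_pi_shift (f : deck q) y g : p (y, g) = p (f y, phi f y g).
Proof. by apply/twist_piP; exists f. Qed.

Lemma twist_pi_fibre y c : q y = twist_proj c -> exists g, p (y, g) = c.
Proof.
have [[y' g] <-] := twist_pi_surj c; rewrite twist_proj_pi /= => qy.
have [f <-] := galois_trans galq (esym qy).
by exists (phi f y' g); rewrite -twist_pi_shift.
Qed.

Lemma twist_sheaf : sheaf Q.
Proof.
move=> F f oF; pose F' := [set p @^-1` V | V in F].
have oF' : F' `<=` open.
  by move=> _ [V FV <-]; move/continuousP: twist_pi_continuous; apply; exact: oF.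
have e : p @^-1` (\bigcup_(V in F) V) = \bigcup_(V in F') V.
  apply/seteqP; split=> [z [V FV Vz]|z [_ [V FV <-] Vz]]; last by exists V.
  by exists (p @^-1` V) => //; exists V.
have [h1 h2] := manifold_sheaf manYG (f \o p) oF'.
rewrite -e in h1 h2; split=> [H V FV|H].
  by apply: (h1 H); exists V.
by apply: h2 => _ [V FV <-]; exact: H.
Qed.

Lemma twist_ext (f g : Q -> Cx R) c :
  (\forall z \near c, f z = g z) -> hol_near f c -> hol_near g c.
Proof.
move=> /near_open[N [oN Nc fg]] hf.
have [z zc] := twist_pi_surj c.
have [W [oW Wc hW]] := hf.
pose O := N `&` W; have oO : open O by exact: openI.
have opO : open (p @^-1` O) by move/continuousP: twist_pi_continuous; exact.
exists O; split; [exact: oO|by []|suff : hol (p @^-1` O) (g \o p) by []].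
apply/(sheaf_hol_near _ (manifold_sheaf manYG) opO) => w Ow.
have [_ eP _] := anaYG.
apply: (eP (f \o p)).
  by apply: filterS (open_near opO Ow) => w' [Nw' _]; exact: fg.
exists (p @^-1` W); split; [|exact: Ow.2|exact: hW].
by move/continuousP: twist_pi_continuous; exact.
Qed.

Section Sheet.
Variables (V : set Y) (U : set X) (s : X ->
  Y) (ls : local_section q V U s) (z0 : P).

(** The inverse of the projection on V x G; the value z0 is used away from the
    image. *)
Definition twist_sec (c : Q) : P := xget z0 [set z | V z.1 /\ p z = c].

Lemma twist_secK z : V z.1 -> twist_sec (p z) = z.
Proof.
move=> Vz; apply: xget_unique; first by split.
move=> z' [Vz' /esym/twist_piP[f fz]].
have [_ _ sV _] := ls.
have e : z.1 = z'.1.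
  rewrite -(sV _ Vz').2 -[LHS](sV _ Vz).2 -fz /=; congr s.
  by rewrite deck_over.
case: z z' Vz Vz' fz e => y g [y' g'] /= _ _ fz e; subst y'.
by congr pair; exact: esym (twist_free (congr1 fst fz) fz).
Qed.

(** The preimage of the image of W in Y x G consists of translates of W, on
    each of which the composite with the projection is a translation. *)
Lemma twist_sec_hol_map_at z : V z.1 -> hol_map_at twist_sec (p z).
Proof.
move=> Vz; have [[oV _] _ _ _] := ls.
have oVG : open [set z : P | V z.1].
  by apply: open_comp oV => w _; exact: fst_continuous_at.
split.
  move=> N; rewrite twist_secK// => /near_open[ O [oO Oz ON]].
  have oOV : open (O `&` [set z : P | V z.1]) by exact: openI.
  have H : (p @` (O `&` [set z : P | V z.1])) (p z) by exists z.
  have H' := open_near (twist_pi_open oOV) H.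
  apply: filterS H' => _ [w [Ow Vw] <-].
  by apply: ON; rewrite twist_secK.
move=> u; rewrite twist_secK// => -[W [oW Wz hW]].
pose O := W `&` [set z : P | V z.1].
have oO : open O by exact: openI.
exists (p @` O); split; [exact: twist_pi_open|by exists z|].
have opO : open (p @^-1` (p @` O)).
  by move/continuousP: twist_pi_continuous; apply; exact: twist_pi_open.
suff : hol (p @^-1` (p @` O)) (u \o twist_sec \o p) by [].
apply/(sheaf_hol_near _ (manifold_sheaf manYG) opO) => z' [ o Oo
  /esym/twist_piP[f fz']].
have hf := twist_hol_map_at f z'.
have [cf hf'] := hf.
have [_ eP _] := anaYG.
have huo : hol_near u (twist phi f z') by rewrite fz'; exists W; split;
  [exact: oW|exact: Oo.1|exact: hW].
have := hf' u huo; apply: eP.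
have H : \forall w \near z', O (twist phi f w) by apply: cf; rewrite fz';
  exact: (open_near oO Oo).
apply: filterS H => w [Ww Vw] /=.
have -> : p w = p (twist phi f w) by apply/twist_piP; exists f.
by rewrite twist_secK.
Qed.

End Sheet.

Lemma twist_quot_hol_map_at (N : hol_space R) (f : Q -> N) :
  (forall z, hol_map_at (f \o p) z) -> forall c, hol_map_at f c.
Proof.
move=> hf.
have cf : continuous f.
  by apply/quotient_continuous => z; have [] := hf z.
move=> c; split; first exact: cf.
move=> u [W [oW Wc hW]].
have oW' : open (f @^-1` W) by move/continuousP: cf; exact.
have opW : open (p @^-1` (f @^-1` W)) by move/continuousP: twist_pi_continuous;
  exact.
exists (f @^-1` W); split; [exact: oW'|exact: Wc|].
suff : hol (p @^-1` (f @^-1` W)) ((u \o f) \o p) by [].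
apply/(sheaf_hol_near _ (manifold_sheaf manYG) opW) => z Wz.
by have [_] := hf z; apply; exists W.
Qed.

Lemma twist_proj_hol_map_at c : hol_map_at (@twist_proj _ _ _ _ _ phi) c.
Proof.
move: c; apply: twist_quot_hol_map_at => z.
have -> : @twist_proj _ _ _ _ _ phi \o p = q \o fst.
  by apply/funext => w; rewrite /= twist_proj_pi.
refine (@hol_map_at_comp _ P Y X fst q z _ _); last exact: hq.
exact: hol_map_at_fst.
Qed.

(** Points over distinct points of X are separated by the projection to X; points
    over the same point of X are separated inside one sheet V x G. *)
Lemma twist_hausdorff : hausdorff_space Q.
Proof.
apply/hausdorffP => c c' cc'.
have cproj : continuous (@twist_proj _ _ _ _ _ phi).
  by move=> d; have [] := twist_proj_hol_map_at d.
have [e|ne] := pselect (twist_proj c = twist_proj c'); last first.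
  by apply: hausdorff_sep cproj ne; case: manX.
have [y qy] := galois_surj galq (twist_proj c).
have [g gc] := twist_pi_fibre qy.
have [g' gc'] := twist_pi_fibre (etrans qy e).
have [V [U [s [ls Vy]]]] := covering_section manX manY y covq.
have [[oV _] _ _ _] := ls.
have hYG : hausdorff_space P by case: manYG.
have gg' : (y, g) <> (y, g') by move=> gg'; apply: cc'; rewrite -gc -gc' gg'.
have [ O [ O' [oO oO' Oz Oz' OO']]] := (hausdorffP _).1 hYG _ _ gg'.
pose VG : set P := [set z : P | V z.1].
have oVG : open VG.
  by apply: open_comp oV => w _; exact: fst_continuous_at.
exists (p @` (O `&` VG)), (p @` (O' `&` VG)); split.
- by apply: twist_pi_open; exact: openI.
- by apply: twist_pi_open; exact: openI.
- by exists (y, g).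
- by exists (y, g').
move=> _ [z [Oz1 Vz] <-] [z' [Oz1' Vz'] zz'].
have zz : z = z'.
  by rewrite -(twist_secK ls (y, g) Vz) -zz' (twist_secK ls (y, g) Vz').
by apply: (OO' z) => //; rewrite zz.
Qed.

Lemma twist_manifold : complex_manifold Q.
Proof.
split.
- exact: twist_hausdorff.
- apply: (image_second_countable twist_pi_continuous twist_pi_open twist_pi_surj).
  by case: manYG.
- exact: twist_sheaf.
move=> c; have [z <-] := twist_pi_surj c.
have [V [U [s [ls Vz]]]] := covering_section manX manY z.1 covq.
have [[oV _] _ _ _] := ls.
apply: (@chart_push _ P Q p (twist_sec V z) [set z : P | V z.1] z manYG
  twist_sheaf twist_ext).
- by apply: open_comp oV => w _; exact: fst_continuous_at.
- by [].
- by move=> O oO _; exact: twist_pi_open.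
- by move=> w; exact: (twist_secK ls z).
- by move=> w _; exact: twist_pi_hol_map_at.
- by move=> w; exact: (twist_sec_hol_map_at ls z).
Qed.

(** The G-coordinate of c over y, with g0 as value when c does not lie over
    q y. *)
Definition twist_coord (g0 : G) (y : Y) (c : Q) : G :=
    xget g0 [set h | p (y, h) = c].

Lemma twist_coordK g0 y g : twist_coord g0 y (p (y, g)) = g.
Proof. by apply: xget_unique => // h; exact: twist_pi_inj. Qed.

(** The multiplication of the quotient, defined with a representative
    z of the first class, equals (y, g).(y, h) = (y, gh) for every y since each
    phi_f(y) is a homomorphism. *)
Lemma twist_trivialized g0 :
  @trivialized R X Y q G (quot_bundle phi) (fun y g => p (y, g)) (twist_coord g0).
Proof.
have KV y c : q y = twist_proj c -> p (y, twist_coord g0 y c) = c.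
  by move=> /twist_pi_fibre[g <-]; rewrite twist_coordK.
split.
- by move=> y g; exact: twist_proj_pi.
- move=> z; have -> : (fun z : P => p (z.1, z.2)) = p by apply/funext => -[].
  exact: twist_pi_hol_map_at.
- by move=> y g; exact: twist_coordK.
- exact: KV.
- move=> M f e m aM hf he fe.
  have [V [U [s [ls Vy]]]] := covering_section manX manY (f m) covq.
  have [[oV _] _ _ _] := ls.
  pose z0 : P := (f m, g0).
  have secE m' : q (f m') = twist_proj (e m') -> V (f m') ->
      twist_sec V z0 (e m') = (f m', twist_coord g0 (f m') (e m')).
    move=> qf Vf; rewrite -[in LHS](KV _ _ qf).
    exact: (twist_secK ls z0 (z := (f m', _))).
  have fem := nbhs_singleton fe.
  have Vn : \forall m' \near m, V (f m') := hf.1 _ (open_near oV Vy).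
  apply: (@hol_map_at_eq _ _ _ (fun m' => (twist_sec V z0 (e m')).2)) => //.
    by apply: filterS2 fe Vn => m' qf Vf; rewrite secE.
  refine (@hol_map_at_comp _ M P G (fun m' => twist_sec V z0 (e m')) snd m _ _);
    last exact: hol_map_at_snd.
  refine (@hol_map_at_comp _ M Q P e (twist_sec V z0) m he _).
  rewrite -(KV _ _ fem); exact: (twist_sec_hol_map_at ls z0 (z := (f m, _))).
- move=> x y g h a b ea eb.
  have -> : val (gmul a b) = twist_mul (val a) (val b) by [].
  rewrite ea eb /twist_mul.
  have /twist_piP[f /esym ->] : p (y, g) = p (repr (p (y,
    g))) by rewrite [RHS]reprK.
  rewrite /=; set k := xget _ _.
  have -> : k = phi f y h.
    apply: xget_unique; first by rewrite /= -twist_pi_shift.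
    by move=> k' /=; rewrite (twist_pi_shift f y h) => /twist_pi_inj.
  have [fM _] := aut_hom (phi f y).
  by rewrite -fM -twist_pi_shift.
Qed.

Lemma twist_is_cocycle g0 f y g : phi f y g = twist_coord g0 (f y) (p (y, g)).
Proof. by rewrite (twist_pi_shift f) twist_coordK. Qed.

End Twist.
End Quotient.

(** * Isomorphism classes *)

Section Classes.
Variables (T : Type) (r : T -> T -> Prop).

Lemma classes_ext (a b : classes r) : sval a = sval b -> a = b.
Proof.
case: a b => [A a] [B b] /= AB; subst B.
by congr exist; exact: Prop_irrelevance.
Qed.

Lemma class_of_surj (a : classes r) : exists t, a = class_of r t.
Proof. by case: a => A [t At]; exists t; exact: classes_ext. Qed.

Hypotheses (rr : forall t, r t t) (rs : forall t u, r t u -> r u t).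
Hypothesis (rt : forall t u v, r t u -> r u v -> r t v).

Lemma class_of_eq t u : class_of r t = class_of r u <-> r t u.
Proof.
split=> [/(congr1 sval) /= e|tu]; first by rewrite e.
apply: classes_ext; apply/funext => v; apply/propext; split; first exact/rt/rs.
exact: rt.
Qed.

End Classes.

(** A map that preserves and reflects the relations and meets every class
    induces a bijection of classes. *)
Lemma classes_bijection (S T : Type) (r : S -> S -> Prop) (r' : T -> T ->
    Prop) (h : S -> T) :
  (forall s, r s s) -> (forall s t, r s t -> r t s) -> (forall s t u, r s t ->
    r t u -> r s u) ->
  (forall s, r' s s) -> (forall s t, r' s t -> r' t s) ->
    (forall s t u, r' s t -> r' t u -> r' s u) ->
  (forall s t, r s t <-> r' (h s) (h t)) -> (forall t, exists s, r' t (h s)) ->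
  exists F : classes r -> classes r', bijective F /\ forall s,
    F (class_of r s) = class_of r' (h s).
Proof.
move=> rr rs rt rr' rs' rt' hr hs.
pose rep (a : classes r) := projT1 (cid (class_of_surj a)).
have repP a : a = class_of r (rep a) := projT2 (cid (class_of_surj a)).
pose rep' (b : classes r') := projT1 (cid (class_of_surj b)).
have rep'P b : b = class_of r' (rep' b) := projT2 (cid (class_of_surj b)).
pose pre t := projT1 (cid (hs t)).
have preP t : r' t (h (pre t)) := projT2 (cid (hs t)).
have FE s : class_of r' (h (rep (class_of r s))) = class_of r' (h s).
  apply/(class_of_eq rr' rs' rt'); apply/hr; apply/(class_of_eq rr rs rt).
  by rewrite -repP.
exists (fun a => class_of r' (h (rep a))); split=> //.
exists (fun b => class_of r (pre (rep' b))).
- move=> a; rewrite [RHS]repP; apply/(class_of_eq rr rs rt); apply/hr.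
  apply: (rt' _ _ _ (rs' _ _ (preP _))).
  by apply/(class_of_eq rr' rs' rt'); rewrite -rep'P.
- move=> b; rewrite FE [RHS]rep'P; apply/(class_of_eq rr' rs' rt').
  exact: rs'.
Qed.

Section BundleIso.
Context {R : realType} (X : hol_space R).

Lemma bundle_iso_sym (E E' : fib_space X) : bundle_iso E E' -> bundle_iso E' E.
Proof. by move=> [f [g [mf mg fK gK]]]; exists g, f. Qed.

Lemma bundle_mor_comp (E E' E'' : fib_space X) (f : E -> E') (g : E' -> E'') :
  analytic_space E -> analytic_space E' -> bundle_mor f -> bundle_mor g ->
    bundle_mor (g \o f).
Proof.
move=> aE aE' mf mg.
have [hf pf fM] := bundle_mor_elim aE mf; have [hg pg gM] := bundle_mor_elim aE' mg.
apply: (bundle_mor_intro aE) => [z|z|x a b a'' b'' ea eb].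
- by apply: hol_map_at_comp; [exact: hf|exact: hg].
- by rewrite /= pg pf.
have fx (c : fibre E x) : (@proj _ X E' @^-1` [set x]) (f (val c)).
  by rewrite /= pf; exact: (in_subP c).
pose a' : fibre E' x := in_sub (fx a); pose b' : fibre E' x := in_sub (fx b).
by rewrite (gM x a' b')// (fM x a b).
Qed.

Lemma bundle_iso_trans (E E' E'' : fib_space X) :
  analytic_space E -> analytic_space E' -> analytic_space E'' ->
  bundle_iso E E' -> bundle_iso E' E'' -> bundle_iso E E''.
Proof.
move=> aE aE' aE'' [f [g [mf mg fK gK]]] [f' [g' [mf' mg' fK' gK']]].
exists (f' \o f), (g \o g'); split.
- exact: bundle_mor_comp mf'.
- exact: bundle_mor_comp mg.
- exact: can_comp fK' fK.
- exact: can_comp gK gK'.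
Qed.

Lemma bundle_iso_refl (E : fib_space X) : analytic_space E -> bundle_iso E E.
Proof.
move=> aE; have m : bundle_mor (@id E).
  apply: (bundle_mor_intro aE) => [z|z|x a b a' b' ea eb] //.
    exact: hol_map_at_id.
  have -> : a' = a by exact/val_inj.
  by have -> : b' = b by exact/val_inj.
by exists id, id; split.
Qed.

End BundleIso.

Section Main.
Context {R : realType}.
Variables (X Y : hol_space R) (q : Y -> X) (G : grp_space R).
Hypotheses (manX : complex_manifold X) (manY : complex_manifold Y).
Hypotheses (galq : galois_cover q) (lieG : complex_lie_group G).

Lemma quot_bundle_trivialized (phi : crossed q G) : exists B : Y ->
    quot_bundle phi -> G,
  @trivialized R X Y q G (quot_bundle phi) (fun y g => twist_pi phi (y, g)) B /\
  forall f y g, phi f y g = B (f y) (twist_pi phi (y, g)).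
Proof.
have [g0 _] : exists g0 : G, True by case: lieG => _ _ _ [g0 _ _]; exists g0.
exists (@twist_coord _ _ _ _ _ phi g0); split; first exact: twist_trivialized.
by move=> f y g; exact: (twist_is_cocycle manX manY galq).
Qed.

Lemma quot_bundle_piG (phi : crossed q G) : piG_bundle q G (quot_bundle phi).
Proof.
have mQ : complex_manifold (quot_bundle phi) :=
  twist_manifold manX manY galq lieG phi.
have hp c : hol_map_at (@proj _ X (quot_bundle phi)) c.
  exact: (twist_proj_hol_map_at manY galq lieG).
have [B [pB _]] := quot_bundle_trivialized phi.
split.
- exact: (triv_group_bundle manX manY galq lieG mQ hp pB).
- exact: (triv_pullback_iso manY lieG mQ pB).
Qed.

Lemma group_bundle_proj_hol (E : fib_space X) : group_bundle E ->
  forall e, hol_map_at (@proj _ X E) e.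
Proof. by move=> [mE hp _ _]; exact/(holomorphicP _ (manifold_sheaf mE)). Qed.

(** E and the quotient defined by its crossed morphism have the same crossed
    morphism, so l = id glues. *)
Lemma piG_bundle_quot (E : fib_space X) : piG_bundle q G E ->
  exists phi : crossed q G, bundle_iso E (quot_bundle phi).
Proof.
move=> [gE iE]; have mE : complex_manifold E by case: gE.
have [A [B pE]] := piG_trivialized manY lieG mE iE.
have [phi phiE] := cocycle_exists manY lieG pE.
have [gQ _] := quot_bundle_piG phi;
  have mQ : complex_manifold (quot_bundle phi) by case: gQ.
have [C [pC phiC]] := quot_bundle_trivialized phi.
have manG : complex_manifold G by case: lieG.
have [||||||l lP] := @aut_maps_exists R Y G manY lieG (fun _ => id)
  (fun _ => id) => //.
- exact: hol_map_at_snd.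
- by move=> y g; exact: hol_map_at_id.
exists phi.
apply: (bundle_iso_of_aut_maps manX manY galq lieG (l := l) mE mQ _ _ pE pC).
- exact: group_bundle_proj_hol.
- exact: group_bundle_proj_hol.
by move=> f y g; have [-> _] := lP (f y); have [-> _] := lP y; rewrite -phiE phiC.
Qed.

(** In coordinates, gluing along l is the relation that l conjugates phi to
    phi'. *)
Lemma quot_bundle_iso (phi phi' : crossed q G) :
  bundle_iso (quot_bundle phi) (quot_bundle phi') <-> crossed_conj phi phi'.
Proof.
have [B [pB phiB]] := quot_bundle_trivialized phi.
have [B' [pB' phiB']] := quot_bundle_trivialized phi'.
have [gQ _] := quot_bundle_piG phi;
  have mQ : complex_manifold (quot_bundle phi) by case: gQ.
have [gQ' _] := quot_bundle_piG phi';
  have mQ' : complex_manifold (quot_bundle phi') by case: gQ'.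
split=> [iso|[l lP]].
  have [l lE] := aut_maps_of_bundle_iso manY lieG mQ mQ' pB pB' iso.
  exists l => f y g; rewrite /maps_act /= phiB lE -phiB'.
  by rewrite aut_invK.
apply: (bundle_iso_of_aut_maps manX manY galq lieG (l := l) mQ mQ' _ _ pB pB').
- exact: group_bundle_proj_hol.
- exact: group_bundle_proj_hol.
by move=> f y g; rewrite -phiB -phiB' lP /maps_act /= aut_funK.
Qed.

End Main.

Theorem theorem2p20 (R : realType) (X Y : hol_space R) (q : Y -> X)
    (G : grp_space R)
    (manX : complex_manifold X) (connX : connected [set: X])
    (manY : complex_manifold Y) (galq : galois_cover q)
    (lieG : complex_lie_group G) :
  (forall E : fib_space X, piG_bundle q G E ->
     exists phi : crossed q G, bundle_iso E (quot_bundle phi)) /\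
  (forall phi phi' : crossed q G,
     bundle_iso (quot_bundle phi) (quot_bundle phi') <-> crossed_conj phi phi') /\
  (exists (quotP : forall phi : crossed q G, piG_bundle q G (quot_bundle phi))
     (F : classes (@crossed_conj R X Y q G) ->
          classes (fun E E' : piG_bundle_type q G => bundle_iso E E')),
     bijective F /\
     forall phi : crossed q G,
       F (class_of (@crossed_conj R X Y q G) phi) =
       class_of (fun E E' : piG_bundle_type q G => bundle_iso E E')
         (PiGBundle (quotP phi))).
Proof.
have conjP := quot_bundle_iso manX manY galq lieG.
have quotP := quot_bundle_piG manX manY galq lieG.
have classify := piG_bundle_quot manX manY galq lieG.
have aE (E : piG_bundle_type q G) : analytic_space E.
  by have [[mE _ _ _] _] := piG_bundleP E; exact: manifold_analytic.
have aQ phi : analytic_space (quot_bundle phi) := aE (PiGBundle (quotP phi)).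
split; first exact: classify.
split; first exact: conjP.
exists quotP; apply: (classes_bijection (h := fun phi => PiGBundle (quotP phi))).
- by move=> phi; exact: (conjP phi phi).1 (bundle_iso_refl (aQ phi)).
- move=> phi phi' c; apply: (conjP phi' phi).1.
  exact: (bundle_iso_sym ((conjP phi phi').2 c)).
- move=> phi phi' phi'' c c'; apply: (conjP phi phi'').1.
  exact: (bundle_iso_trans (aQ phi) (aQ phi') (aQ phi'') ((conjP _ _).2 c)
    ((conjP _ _).2 c')).
- by move=> E; exact: (bundle_iso_refl (aE E)).
- by move=> E E' i; exact: (bundle_iso_sym i).
- by move=> E E' E'' i i'; exact: (bundle_iso_trans (aE E) (aE E') (aE E'') i i').
- by move=> phi phi'; exact: iff_sym (conjP phi phi').
- by move=> E; have [phi iso] := classify E (piG_bundleP E); exists phi.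
Qed.
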